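(* Consider the time-varying problem $\inf_{x\in\mathbb{R}^n} f(x,t)$ s.t. $h_i(x)=d_i(t)$, $i=1,\dots,m$, for $t\in[0,T]$, and suppose that the Uniform Boundedness and Non-singularity assumptions stated in the context hold. If $x_0$ is a local solution of this problem at $t=0$, then any discrete local trajectory initialized at $x_0$ converges towards the solution $x:[0,T]\to\mathbb{R}^n$ of the ODE $$\dot x=-\frac1\alpha\,\eta(x,t)+\theta(x)\,\dot d(t),\qquad x(0)=x_0,$$ in the sense that, for any choice for each $N$ of a discrete local trajectory $x_0=x_0^{(N)},x_1^{(N)},\dots,x_N^{(N)}$ initialized at $x_0$ with evenly spaced times $t_k=kT/N$, $$\lim_{N\to+\infty}\ \sup_{0\le k\le N}\left\|x_k^{(N)}-x(t_k)\right\|=0.$$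
   Context: Setting: $0<T<\infty$; $f:\mathbb{R}^n\times[0,T]\to\mathbb{R}$ is continuously differentiable; $h_i:\mathbb{R}^n\to\mathbb{R}$ and $d_i:[0,T]\to\mathbb{R}$, $i=1,\dots,m$, are twice continuously differentiable; $f$ is bounded from below, $f(x,t)\ge M$ for a constant $M$; the problem is feasible for every $t\in[0,T]$. $\alpha>0$ is a fixed parameter and $\|\cdot\|$ is the Euclidean norm. Write $h=(h_1,\dots,h_m)^\top$, $d=(d_1,\dots,d_m)^\top$, and let $\mathcal{J}(x)\in\mathbb{R}^{m\times n}$ be the Jacobian of $h$ (its $i$-th row is $\nabla h_i(x)^\top$). Define, where $\mathcal{J}(x)\mathcal{J}(x)^\top$ is invertible, $$\eta(x,t)=\left[I-\mathcal{J}(x)^\top(\mathcal{J}(x)\mathcal{J}(x)^\top)^{-1}\mathcal{J}(x)\right]\nabla_x f(x,t),\qquad \theta(x)=\mathcal{J}(x)^\top(\mathcal{J}(x)\mathcal{J}(x)^\top)^{-1}.$$ A local solution of an optimization problem means a feasible point satisfying its Karush-Kuhn-Tucker (KKT) conditions. Thus $x_0$ is a local solution at $t=0$ if $h(x_0)=d(0)$ and $\nabla_x f(x_0,0)+\mathcal{J}(x_0)^\top\mu=0$ for some $\mu\in\mathbb{R}^m$. Discrete local trajectory: for an integer $N\ge1$ and evenly spaced times $t_k=kT/N$, $k=0,\dots,N$, a sequence $x_0,x_1,\dots,x_N$ is a discrete local trajectory if $x_0$ is a local solution of the problem at $t=0$ and, for $k=0,\dots,N-1$, $x_{k+1}$ is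 a local solution (KKT point) of the regularized problem $$\inf_{x\in\mathbb{R}^n} f(x,t_{k+1})+\alpha\frac{\|x-x_k\|^2}{2(t_{k+1}-t_k)}\quad\text{s.t. } h_i(x)=d_i(t_{k+1}),\ i=1,\dots,m.$$ Uniform Boundedness assumption: there exist constants $R_1,R_2>0$ such that for any discrete local trajectory (any $N$) and every $k\in\{0,\dots,N\}$, $\|x_k\|\le R_1$ and the objective value at $x_k$ of the regularized problem of which $x_k$ is a local solution is at most $R_2$ (for $k=0$: $f(x_0,0)\le R_2$). Non-singularity assumption: there exists a constant $c>0$ such that for any discrete local trajectory (any $N$), $\sigma_{\min}(\mathcal{J}(x_k))\ge c$ for all $k$, where $\sigma_{\min}$ is the minimal singular value, i.e. $\sigma_{\min}(\mathcal{J})=\sqrt{\lambda_{\min}(\mathcal{J}\mathcal{J}^\top)}$. Under the Uniform Boundedness and Non-singularity assumptions the paper separately establishes that the ODE $\dot x=-\frac1\alpha\,\eta(x,t)+\theta(x)\,\dot d(t)$ with $x(0)=x_0$, where $x_0$ is a local solution at $t=0$, has a unique continuously differentiable solution on $[0,T]$; this is the solution $x$ in the claim. *)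

(* Defs.v *)
From HB Require Import structures.
From mathcomp Require Import all_boot all_order all_algebra.
From mathcomp Require Import all_classical all_reals all_analysis.

Set Implicit Arguments.
Unset Strict Implicit.
Unset Printing Implicit Defensive.

Import Order.TTheory GRing.Theory Num.Theory.
Import numFieldNormedType.Exports.

Local Open Scope classical_set_scope.
Local Open Scope ring_scope.

(* Points of R^n are column vectors.  The norm [`|v|] that the library puts on
   'cV[R]_n is the sup norm, hence the separate Euclidean norm. *)
Definition enorm (R : realType) (n : nat) (v : 'cV[R]_n) : R :=
  Num.sqrt (\sum_(i < n) v i 0 ^+ 2).

(* Derivative relative to the interval [0, T]: two-sided in the interior and
   one-sided at 0 and T.  It only depends on the values of u on [0, T]. *)
Definition diff_quot (R : realType) (V : normedModType R) (u : R -> V)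
    (t s : R) : V :=
  (s - t)^-1 *: (u s - u t).

Definition derivable_on (R : realType) (V : normedModType R) (T : R)
    (u : R -> V) (t : R) : Prop :=
  cvg (diff_quot u t s @[s --> within `[0, T] t^']).

Definition derive_on (R : realType) (V : normedModType R) (T : R)
    (u : R -> V) (t : R) : V :=
  lim (diff_quot u t s @[s --> within `[0, T] t^']).

Definition C1_on (R : realType) (V : normedModType R) (T : R)
    (u : R -> V) : Prop :=
  (forall t : R, t \in `[0, T] -> derivable_on T u t) /\
  {within `[0, T], continuous (derive_on T u)}.

Definition C2_on (R : realType) (V : normedModType R) (T : R)
    (u : R -> V) : Prop :=
  C1_on T u /\ C1_on T (derive_on T u).

Definition grad (R : realType) (n : nat) (g : 'cV[R]_n -> R)
    (x : 'cV[R]_n) : 'cV[R]_n :=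
  \col_(j < n) 'D_(delta_mx j 0) g x.

Definition C1 (R : realType) (n : nat) (g : 'cV[R]_n -> R) : Prop :=
  (forall x, differentiable g x) /\ continuous (grad g).

Definition C2 (R : realType) (n : nat) (g : 'cV[R]_n -> R) : Prop :=
  C1 g /\ forall j : 'I_n, C1 (fun x => grad g x j 0).

(* f is C^1 on R^n x [0, T]: the spatial and the time derivatives exist there
   and are jointly continuous there; nothing is required of f x t for t outside
   [0, T]. *)
Definition C1_strip (R : realType) (n : nat) (T : R)
    (f : 'cV[R]_n -> R -> R) : Prop :=
  [/\ forall (x : 'cV[R]_n) (t : R), t \in `[0, T] -> differentiable (f^~ t) x,
      forall (x : 'cV[R]_n) (t : R), t \in `[0, T] -> derivable_on T (f x) t,
      {within setT `*` `[0, T],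
        continuous (fun p : 'cV[R]_n * R => grad (f^~ p.2) p.1)}
    & {within setT `*` `[0, T],
        continuous (fun p : 'cV[R]_n * R => derive_on T (f p.1) p.2)}].

Definition stack (R : realType) (m : nat) (S : Type) (g : 'I_m -> S -> R)
    (s : S) : 'cV[R]_m :=
  \col_(i < m) g i s.

Definition Jac (R : realType) (n m : nat) (h : 'I_m -> 'cV[R]_n -> R)
    (x : 'cV[R]_n) : 'M[R]_(m, n) :=
  \matrix_(i < m, j < n) grad (h i) x j 0.

(* For m > 0 and a symmetric matrix, the set of real eigenvalues is finite and
   nonempty, so that inf is a minimum. *)
Definition lambda_min (R : realType) (m : nat) (A : 'M[R]_m) : R :=
  inf [set a : R | eigenvalue A a].

Definition sigma_min (R : realType) (m n : nat) (J : 'M[R]_(m, n)) : R :=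
  Num.sqrt (lambda_min (J *m J^T)).

(* [invmx A] is A itself when A is singular, so these maps are meaningful
   only where [Jac h x *m (Jac h x)^T] is invertible. *)
Definition theta_map (R : realType) (n m : nat) (h : 'I_m -> 'cV[R]_n -> R)
    (x : 'cV[R]_n) : 'M[R]_(n, m) :=
  (Jac h x)^T *m invmx (Jac h x *m (Jac h x)^T).

Definition eta_map (R : realType) (n m : nat) (f : 'cV[R]_n -> R -> R)
    (h : 'I_m -> 'cV[R]_n -> R) (x : 'cV[R]_n) (t : R) : 'cV[R]_n :=
  (1%:M - (Jac h x)^T *m invmx (Jac h x *m (Jac h x)^T) *m Jac h x)
    *m grad (f^~ t) x.

(* KKT point of: inf F(x) subject to h(x) = b. *)
Definition local_solution (R : realType) (n m : nat) (F : 'cV[R]_n -> R)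
    (h : 'I_m -> 'cV[R]_n -> R) (b : 'cV[R]_m) (x : 'cV[R]_n) : Prop :=
  stack h x = b /\
  exists mu : 'cV[R]_m, grad F x + (Jac h x)^T *m mu = 0.

(* Objective of the regularized problem at time t', where z is the point
   selected at the previous time t. *)
Definition reg_objective (R : realType) (n : nat) (alpha : R)
    (f : 'cV[R]_n -> R -> R) (t t' : R) (z x : 'cV[R]_n) : R :=
  f x t' + alpha * (enorm (x - z) ^+ 2 / (2 * (t' - t))).

Definition grid (R : realType) (T : R) (N k : nat) : R := k%:R * T / N%:R.

(* Only the values X 0, ..., X N of the sequence X matter. *)
Definition discrete_local_trajectory (R : realType) (n m : nat) (T alpha : R)
    (f : 'cV[R]_n -> R -> R) (h : 'I_m -> 'cV[R]_n -> R) (d : 'I_m -> R -> R)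
    (N : nat) (X : nat -> 'cV[R]_n) : Prop :=
  local_solution (f^~ 0) h (stack d 0) (X 0%N) /\
  forall k, (k < N)%N ->
    local_solution
      (reg_objective alpha f (grid T N k) (grid T N k.+1) (X k))
      h (stack d (grid T N k.+1)) (X k.+1).

Definition uniform_boundedness (R : realType) (n m : nat) (T alpha : R)
    (f : 'cV[R]_n -> R -> R) (h : 'I_m -> 'cV[R]_n -> R)
    (d : 'I_m -> R -> R) : Prop :=
  exists R1 R2 : R, [/\ 0 < R1, 0 < R2 &
    forall (N : nat) (X : nat -> 'cV[R]_n), (0 < N)%N ->
      discrete_local_trajectory T alpha f h d N X ->
      [/\ forall k, (k <= N)%N -> enorm (X k) <= R1,
          f (X 0%N) 0 <= R2
        & forall k, (k < N)%N ->
            reg_objective alpha f (grid T N k) (grid T N k.+1) (X k) (X k.+1)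
              <= R2]].

Definition non_singularity (R : realType) (n m : nat) (T alpha : R)
    (f : 'cV[R]_n -> R -> R) (h : 'I_m -> 'cV[R]_n -> R)
    (d : 'I_m -> R -> R) : Prop :=
  exists c : R, 0 < c /\
    forall (N : nat) (X : nat -> 'cV[R]_n), (0 < N)%N ->
      discrete_local_trajectory T alpha f h d N X ->
      forall k, (k <= N)%N -> c <= sigma_min (Jac h (X k)).

(* C^1 solution on [0, T], with eta = eta_map f h and theta = theta_map h, of
     x' = - (1/alpha) eta(x, t) + theta(x) d'(t),   x(0) = x0.
   The curve has to stay in the domain of eta and theta. *)
Definition ode_solution (R : realType) (n m : nat) (T alpha : R)
    (f : 'cV[R]_n -> R -> R) (h : 'I_m -> 'cV[R]_n -> R) (d : 'I_m -> R -> R)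
    (x0 : 'cV[R]_n) (x : R -> 'cV[R]_n) : Prop :=
  [/\ C1_on T x,
      x 0 = x0,
      forall t : R, t \in `[0, T] -> Jac h (x t) *m (Jac h (x t))^T \in unitmx
    & forall t : R, t \in `[0, T] ->
        derive_on T x t =
          - alpha^-1 *: eta_map f h (x t) t
          + theta_map h (x t) *m stack (fun i => derive_on T (d i)) t].

(* The solution, up to its irrelevant values outside [0, T].  Uniqueness is not
   automatic when f is only C^1, since eta is then merely continuous. *)
Definition unique_ode_solution (R : realType) (n m : nat) (T alpha : R)
    (f : 'cV[R]_n -> R -> R) (h : 'I_m -> 'cV[R]_n -> R) (d : 'I_m -> R -> R)
    (x0 : 'cV[R]_n) (x : R -> 'cV[R]_n) : Prop :=
  ode_solution T alpha f h d x0 x /\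
  forall y : R -> 'cV[R]_n, ode_solution T alpha f h d x0 y ->
    forall t : R, t \in `[0, T] -> y t = x t.

(* Main.v *)
Require Import Defs.
From HB Require Import structures.
From mathcomp Require Import all_boot all_order all_algebra.
From mathcomp Require Import all_classical all_reals all_analysis.
From mathcomp Require Import ring lra.

(** Why the trajectories converge.  Write v for the velocity
    (x_(k+1) - x_k) / (T/N) of a step.  The gradient of the penalty term is
    alpha v, so the KKT condition of the regularized problem reads
      alpha v + grad f(x_(k+1), t_(k+1)) + J(x_(k+1))^T mu = 0,
    and feasibility of two consecutive iterates reads
      J(x_(k+1)) v = d'(t) + small terms.
    The right-hand side of the ODE is exactly the solution of this linear system
    without the small terms ([projected_kkt]), and the system is stable since J^T
    is bounded below by c ([sigma_minP], [kkt_stability]).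

    This gives two estimates.  First, steps are O(T/N) uniformly over all
    trajectories ([traj_step_bound]): comparing the objective with the lower
    bound M shows that they are O(sqrt (T/N)), which makes the second-order
    Taylor remainder of h of order T/N, and stability concludes.  Second, the
    velocity of a step near (z, t) is close to the right-hand side of the ODE at
    (z, t) ([traj_consistent]).

    As f is merely C^1, the right-hand side is only continuous, so a Gronwall
    argument is unavailable and convergence comes from compactness and
    uniqueness.  If the error did not tend to 0, an ultrafilter on the bad
    values of N would yield a limit curve y: the first estimate makes the
    iterates equi-Lipschitz in time, so that y t does not depend on how grid
    points approach t ([scheme_limit]), and the second makes y a solution of the
    ODE ([scheme_limit_derive], [limit_ode_solution]).  By uniqueness y = x.  But
    along the ultrafilter the times of large error converge to some tau, and the
    iterates at those times converge to y tau = x tau, a contradiction. *)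

Set Implicit Arguments.
Unset Strict Implicit.
Unset Printing Implicit Defensive.

Import Order.TTheory GRing.Theory Num.Theory.
Import numFieldNormedType.Exports.

Local Open Scope classical_set_scope.
Local Open Scope ring_scope.

(** * Euclidean norm and inner product *)

Section euclidean.
Variable R : realType.

Definition dot (n : nat) (u v : 'cV[R]_n) : R := (u^T *m v) 0 0.

Lemma dotE n (u v : 'cV[R]_n) : dot u v = \sum_(i < n) u i 0 * v i 0.
Proof. by rewrite /dot mxE; apply: eq_bigr => i _; rewrite mxE. Qed.

Lemma dotC n (u v : 'cV[R]_n) : dot u v = dot v u.
Proof. by rewrite !dotE; apply: eq_bigr => i _; rewrite mulrC. Qed.

Lemma dotDr n (u v w : 'cV[R]_n) : dot u (v + w) = dot u v + dot u w.
Proof. by rewrite /dot mulmxDr mxE. Qed.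

Lemma dotDl n (u v w : 'cV[R]_n) : dot (v + w) u = dot v u + dot w u.
Proof. by rewrite /dot linearD mulmxDl mxE. Qed.

Lemma dotZr n a (u v : 'cV[R]_n) : dot u (a *: v) = a * dot u v.
Proof. by rewrite /dot -scalemxAr mxE. Qed.

Lemma dotZl n a (u v : 'cV[R]_n) : dot (a *: u) v = a * dot u v.
Proof. by rewrite /dot linearZ -scalemxAl mxE. Qed.

Lemma dotNr n (u v : 'cV[R]_n) : dot u (- v) = - dot u v.
Proof. by rewrite -scaleN1r dotZr mulN1r. Qed.

Lemma dotNl n (u v : 'cV[R]_n) : dot (- u) v = - dot u v.
Proof. by rewrite -scaleN1r dotZl mulN1r. Qed.

Lemma dot0r n (u : 'cV[R]_n) : dot u 0 = 0.
Proof. by rewrite /dot mulmx0 mxE. Qed.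

Lemma dot_trmx_mul m n (A : 'M[R]_(m, n)) (u : 'cV[R]_m) (v : 'cV[R]_n) :
  dot (A^T *m u) v = dot u (A *m v).
Proof. by rewrite /dot trmx_mul trmxK mulmxA. Qed.

Lemma enorm_ge0 n (v : 'cV[R]_n) : 0 <= enorm v.
Proof. exact: sqrtr_ge0. Qed.

Lemma sqr_enorm n (v : 'cV[R]_n) : enorm v ^+ 2 = dot v v.
Proof.
rewrite sqr_sqrtr ?dotE; first by apply: eq_bigr => i _; rewrite expr2.
by apply: sumr_ge0 => i _; rewrite sqr_ge0.
Qed.

Lemma dot_ge0 n (v : 'cV[R]_n) : 0 <= dot v v.
Proof. by rewrite -sqr_enorm sqr_ge0. Qed.

Lemma enorm0 n : enorm (0 : 'cV[R]_n) = 0.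
Proof. by apply/eqP; rewrite -sqrf_eq0 sqr_enorm dot0r. Qed.

Lemma enormZ n a (v : 'cV[R]_n) : enorm (a *: v) = `|a| * enorm v.
Proof.
apply/eqP; rewrite -(@eqrXn2 _ 2) ?enorm_ge0 ?mulr_ge0 ?enorm_ge0//.
by rewrite exprMn !sqr_enorm dotZl dotZr mulrA -expr2 real_normK ?num_real.
Qed.

Lemma enormN n (v : 'cV[R]_n) : enorm (- v) = enorm v.
Proof. by rewrite -scaleN1r enormZ normrN1 mul1r. Qed.

Lemma enorm_distC n (u v : 'cV[R]_n) : enorm (u - v) = enorm (v - u).
Proof. by rewrite -opprB enormN. Qed.

Lemma norm_le_enorm n (v : 'cV[R]_n) : `|v| <= enorm v.
Proof.
rewrite [leLHS]/Num.Def.normr/= mx_normrE bigmax_le ?enorm_ge0// => -[i j] _ /=.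
rewrite ord1 -(ler_sqr (normr_ge0 _) (enorm_ge0 _)) real_normK ?num_real//.
rewrite sqr_enorm dotE (bigD1 i)//= -expr2 lerDl.
by apply: sumr_ge0 => k _; rewrite -expr2 sqr_ge0.
Qed.

Lemma enorm_eq0 n (v : 'cV[R]_n) : enorm v = 0 -> v = 0.
Proof.
move=> v0; apply/eqP; rewrite -normr_eq0 eq_le normr_ge0 andbT.
by rewrite (le_trans (norm_le_enorm v))// v0.
Qed.

Lemma cauchy_schwarz n (u v : 'cV[R]_n) : `|dot u v| <= enorm u * enorm v.
Proof.
have [v0|v0] := eqVneq (enorm v) 0.
  by rewrite v0 mulr0 (enorm_eq0 v0) dot0r normr0.
have vv : 0 < dot v v by rewrite -sqr_enorm exprn_gt0// lt_neqAle eq_sym v0 enorm_ge0.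
rewrite -(ler_sqr (normr_ge0 _)) ?mulr_ge0 ?enorm_ge0//; last first.
  by rewrite nnegrE mulr_ge0 ?enorm_ge0.
rewrite real_normK ?num_real// exprMn !sqr_enorm.
have := dot_ge0 (dot v v *: u - dot u v *: v).
rewrite !(dotDl, dotDr, dotNl, dotNr, dotZl, dotZr) (dotC v u).
set a := dot u u; set b := dot u v; set c := dot v v in vv *.
rewrite [leRHS](_ : _ = c * (a * c - b ^+ 2)); last by ring.
by rewrite pmulr_rge0// subr_ge0.
Qed.

Lemma dot_le n (u v : 'cV[R]_n) : dot u v <= enorm u * enorm v.
Proof. exact: le_trans (ler_norm _) (cauchy_schwarz u v). Qed.

Lemma enorm_triangle n (u v : 'cV[R]_n) : enorm (u + v) <= enorm u + enorm v.
Proof.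
rewrite -(ler_sqr (enorm_ge0 _)) ?nnegrE ?addr_ge0 ?enorm_ge0//.
rewrite sqrrD !sqr_enorm !(dotDl, dotDr) (dotC v u).
have := dot_le u v; rewrite mulr2n; lra.
Qed.

Lemma enorm_sum_le n (v : 'cV[R]_n) : enorm v <= \sum_(i < n) `|v i 0|.
Proof.
rewrite -(ler_sqr (enorm_ge0 _)) ?nnegrE ?sumr_ge0//.
rewrite sqr_enorm dotE expr2 big_distrl/=; apply: ler_sum => i _.
rewrite -expr2 -[leLHS]ger0_norm ?sqr_ge0// normrX expr2 ler_wpM2l//.
by rewrite (bigD1 i)//= lerDl sumr_ge0.
Qed.

Lemma enorm_le_bound n (v : 'cV[R]_n) a :
  (forall i, `|v i 0| <= a) -> enorm v <= n%:R * a.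
Proof.
move=> va; apply: le_trans (enorm_sum_le v) _.
rewrite -[X in X%:R]card_ord -sumr_const big_distrl/=; apply: ler_sum => i _.
by rewrite mul1r.
Qed.

Lemma coord_le_norm n (v : 'cV[R]_n) i : `|v i 0| <= `|v|.
Proof.
rewrite [leRHS]/Num.Def.normr/= mx_normrE.
exact: (le_bigmax _ (fun ij : 'I_n * 'I_1 => `|v ij.1 ij.2|) (i, 0)).
Qed.

Lemma enorm_le_norm n (v : 'cV[R]_n) : enorm v <= n%:R * `|v|.
Proof. by apply: enorm_le_bound => i; exact: coord_le_norm. Qed.

End euclidean.

(** * Euclidean topology and the least singular value *)

Section topology.
Variable R : realType.

Lemma cvg_cV (S : Type) (F : set_system S) (FF : Filter F) n
    (u : S -> 'cV[R]_n) (l : 'cV[R]_n) :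
  (forall i, u s i 0 @[s --> F] --> l i 0) -> u @ F --> l.
Proof.
move=> ul; apply/cvgrPdist_le => e e0; near=> s.
rewrite [leLHS]/Num.Def.normr/= mx_normrE bigmax_le ?(ltW e0)// => -[i j] _ /=.
rewrite ord1 !mxE; move: i; near: s; apply: filter_forall => i.
by have /cvgrPdist_le := ul i; apply.
Unshelve. all: by end_near. Qed.

Lemma cvg_coord (S : Type) (F : set_system S) (FF : Filter F) n
    (u : S -> 'cV[R]_n) (l : 'cV[R]_n) i :
  u @ F --> l -> u s i 0 @[s --> F] --> l i 0.
Proof.
move=> ul; apply: (@continuous_cvg _ _ _ F FF u (fun v => v i 0) l) ul.
exact: coord_continuous.
Qed.

Lemma cvg_mulmx (S : Type) (F : set_system S) (FF : Filter F) m n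
    (A : S -> 'M[R]_(m, n)) (v : S -> 'cV[R]_n) (B : 'M[R]_(m, n)) (w : 'cV[R]_n) :
  (forall i j, A s i j @[s --> F] --> B i j) -> v @ F --> w ->
  A s *m v s @[s --> F] --> B *m w.
Proof.
move=> AB vw; apply: cvg_cV => i; rewrite mxE.
under eq_fun do rewrite mxE.
apply: cvg_big => [|j _]; [exact: add_continuous|]; apply: cvgM; first exact: AB.
exact: cvg_coord.
Qed.

Lemma cvg_enorm (S : Type) (F : set_system S) (FF : Filter F) n
    (u : S -> 'cV[R]_n) (l : 'cV[R]_n) :
  u @ F --> l -> enorm (u s) @[s --> F] --> enorm l.
Proof.
move=> ul; apply: (@continuous_cvg _ _ _ F FF _ Num.sqrt).
  exact: sqrt_continuous.
apply: cvg_big => [|i _]; [exact: add_continuous|]; rewrite expr2; under eq_fun do rewrite expr2.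
by apply: cvgM; exact: cvg_coord.
Qed.

Lemma cvg_enorm0 (S : Type) (F : set_system S) (FF : Filter F) n
    (u : S -> 'cV[R]_n) (l : 'cV[R]_n) :
  enorm (u s - l) @[s --> F] --> 0 -> u @ F --> l.
Proof.
move=> /cvgrPdist_le ul; apply/cvgrPdist_le => e e0.
near=> s; have : `|0 - enorm (u s - l)| <= e by near: s; exact: ul.
rewrite sub0r normrN ger0_norm ?enorm_ge0// enorm_distC.
exact: le_trans (norm_le_enorm _).
Unshelve. all: by end_near. Qed.

Lemma continuous_enorm n : continuous (@enorm R n).
Proof. by move=> v; apply: (@cvg_enorm _ (nbhs v) _ n id v); exact: cvg_id. Qed.

Lemma compact_enorm_ball n (r : R) : compact [set v : 'cV[R]_n | enorm v <= r].
Proof.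
have trmxK_cont : continuous (fun u : 'rV[R]_n => u^T).
  move=> u; apply: (@cvg_cV _ (nbhs u)) => i; rewrite mxE; under eq_fun do rewrite mxE.
  exact: coord_continuous.
have -> : [set v : 'cV[R]_n | enorm v <= r] =
    (fun u : 'rV[R]_n => u^T) @` [set u | enorm u^T <= r].
  apply/seteqP; split => [v vr|_ [u ur <-]//].
  by exists v^T; rewrite /= trmxK.
apply: continuous_compact; first exact: continuous_subspaceT.
apply: bounded_closed_compact; last first.
  apply: (@preimage_closed _ _ (fun u : 'rV[R]_n => enorm u^T) [set x | x <= r]);
    last exact: closed_le.
  move=> u _; exact: (@cvg_enorm _ (nbhs u) _ n (fun w : 'rV[R]_n => w^T) _ (trmxK_cont u)).
exists r; split; first exact: num_real.
move=> M rM u /= ur; rewrite (le_trans _ (ltW rM))// (le_trans _ ur)//.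
apply: le_trans (norm_le_enorm _).
rewrite [leLHS]/Num.Def.normr/= mx_normrE bigmax_le// => -[i j] _ /=.
by rewrite ord1; have := coord_le_norm u^T j; rewrite mxE.
Qed.

(** The minimum of |J^T w| over the unit sphere is attained and its square is an
    eigenvalue of J J^T, hence is at least [lambda_min]. *)
Lemma sigma_minP (m n : nat) (J : 'M[R]_(m, n)) (c : R) (u : 'cV[R]_m) :
  c <= sigma_min J -> c * enorm u <= enorm (J^T *m u).
Proof.
move=> cJ.
pose Q (w : 'cV[R]_m) := enorm (J^T *m w).
have Qcont : continuous Q.
  move=> w; apply: (@cvg_enorm _ (nbhs w)); apply: cvg_mulmx => // i j; exact: cvg_cst.
have QZ a w : Q (a *: w) = `|a| * Q w by rewrite /Q -scalemxAr enormZ.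
have [->|u0] := eqVneq u 0; first by rewrite enorm0 mulr0 enorm_ge0.
have eu0 : 0 < enorm u.
  rewrite lt_neqAle enorm_ge0 andbT eq_sym; apply: contra_neq u0; exact: enorm_eq0.
pose sphere := [set w : 'cV[R]_m | enorm w = 1].
have normalize w : 0 < enorm w -> sphere ((enorm w)^-1 *: w).
  move=> w0; rewrite /sphere/= enormZ ger0_norm ?invr_ge0 ?ltW//.
  by rewrite mulVf ?gt_eqF.
have sphere_compact : compact sphere.
  apply: (@subclosed_compact _ _ [set w | enorm w <= 1]).
  - apply: (@preimage_closed _ _ (@enorm R m) [set x | x = 1]);
      last exact: closed_eq.
    by move=> w _; exact: continuous_enorm.
  - exact: compact_enorm_ball.
  - by move=> w /= ->.
have sphere0 : sphere !=set0.
  by exists ((enorm u)^-1 *: u); exact: normalize.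
have [w0 /set_mem w0S w0min] :=
  compact_EVT_min sphere0 sphere_compact (continuous_subspaceT Qcont).
pose lam := Q w0 ^+ 2.
have Qge w : Q w0 * enorm w <= Q w.
  have [->|w_neq0] := eqVneq w 0; first by rewrite enorm0 mulr0 enorm_ge0.
  have ew0 : 0 < enorm w.
    rewrite lt_neqAle enorm_ge0 andbT eq_sym.
    by apply: contra_neq w_neq0; exact: enorm_eq0.
  rewrite -ler_pdivlMr// mulrC.
  have <- : Q ((enorm w)^-1 *: w) = (enorm w)^-1 * Q w.
    by rewrite QZ ger0_norm// invr_ge0 ltW.
  by apply: w0min; rewrite inE; exact: normalize.
suff clam : c <= Q w0.
  by rewrite (le_trans _ (Qge u))// ler_wpM2r// ltW.
pose A := J *m J^T.
have QA w : Q w ^+ 2 = dot w (A *m w).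
  by rewrite /Q sqr_enorm dot_trmx_mul mulmxA.
(* w0 minimizes the nonnegative form Q w ^+ 2 - lam |w|^2, which vanishes at
   w0, so its gradient 2 r there has to be 0. *)
have [r Aw0] : exists r, A *m w0 = r + lam *: w0.
  by exists (A *m w0 - lam *: w0); rewrite subrK.
have quad s : 0 <= 2 * s * dot r r + s ^+ 2 * (Q r ^+ 2 - lam * dot r r).
  have : (Q w0 * enorm (w0 + s *: r)) ^+ 2 <= Q (w0 + s *: r) ^+ 2.
    by rewrite ler_sqr ?nnegrE ?mulr_ge0 ?enorm_ge0// Qge.
  rewrite exprMn -/lam sqr_enorm QA mulmxDr -scalemxAr.
  have sA : dot w0 (A *m r) = dot r (A *m w0).
    by rewrite /A -!mulmxA -(dot_trmx_mul J w0) -(dot_trmx_mul J r) dotC.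
  have w01 : dot w0 w0 = 1 by rewrite -sqr_enorm w0S expr1n.
  rewrite !(dotDl, dotDr, dotZl, dotZr) sA -(QA r) Aw0 !(dotDr, dotZr).
  rewrite (dotC r w0) w01.
  have : dot w0 r + lam = lam.
    by rewrite -[X in _ + X]mulr1 -w01 -dotZr -dotDr -Aw0 -QA.
  move=> /(congr1 (fun z => z - lam)); rewrite addrK subrr => ->.
  lra.
(* A negative step along r would contradict [quad], by first-order terms. *)
have r0 : dot r r = 0.
  apply/eqP; rewrite eq_le dot_ge0 andbT leNgt; apply/negP => rr0.
  pose q := Q r ^+ 2; have q0 : 0 <= q by exact: sqr_ge0.
  have lam0 : 0 <= lam by exact: sqr_ge0.
  have lr0 : 0 <= lam * dot r r by rewrite mulr_ge0 // ltW.
  have q1 : 0 < q + 1 by rewrite ltr_wpDl.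
  have := quad (- (dot r r / (q + 1))).
  set b := dot r r in rr0 lr0 *; set t := b / (q + 1).
  have t0 : 0 < t by rewrite divr_gt0.
  have tq : t * (q + 1) = b by rewrite divfK ?gt_eqF.
  rewrite leNgt => /negP; apply; rewrite sqrrN -/q.
  have : t * b > 0 by rewrite mulr_gt0.
  have : t * (t * q) < t * b by rewrite ltr_pM2l// -tq ltr_pM2l// ltrDl.
  have : 0 <= t * (t * (lam * b)) by exact: mulr_ge0 (ltW t0) (mulr_ge0 (ltW t0) lr0).
  rewrite expr2; nra.
have {}Aw0 : A *m w0 = lam *: w0.
  rewrite Aw0 (enorm_eq0 (v := r)) ?add0r//.
  by apply/eqP; rewrite -sqrf_eq0 sqr_enorm r0.
have eigen_lam : eigenvalue A lam.
  apply/eigenvalueP; exists w0^T.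
    apply: trmx_inj; rewrite trmx_mul linearZ/= !trmxK /A trmx_mul trmxK.
    exact: Aw0.
  apply/eqP => /(congr1 trmx); rewrite trmxK trmx0 => w00.
  by move: w0S; rewrite w00 /sphere/= enorm0 => /eqP; rewrite eq_sym oner_eq0.
have lam_ge : lambda_min A <= lam.
  apply: ge_inf => //; exists 0 => a /eigenvalueP[v vA v0].
  have {}vA : A *m v^T = a *: v^T.
    by rewrite /A -[J *m _]trmxK trmx_mul trmxK -trmx_mul vA linearZ.
  have vv0 : 0 < dot v^T v^T.
    rewrite -sqr_enorm exprn_gt0// lt_neqAle enorm_ge0 andbT eq_sym.
    by apply: contra_neq v0 => /enorm_eq0 /(congr1 trmx); rewrite trmxK trmx0.
  by rewrite -(pmulr_lge0 _ vv0) -dotZr -vA -QA sqr_ge0.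
have l0 : 0 <= lam by exact: sqr_ge0.
apply: (le_trans cJ); rewrite /sigma_min -/A (le_trans (ler_wsqrtr lam_ge))//.
by rewrite /lam sqrtr_sqr ger0_norm// enorm_ge0.
Qed.

End topology.

(** * Mean value theorems and Taylor estimates *)

Section calculus.
Variable R : realType.

Lemma compact_within_bound (S : topologicalType) n (A : set S)
    (u : S -> 'cV[R]_n) : compact A -> {within A, continuous u} ->
  exists2 K : R, 0 <= K & forall s, A s -> enorm (u s) <= K.
Proof.
move=> cA uc.
have [K [_ uK]] := compact_bounded (continuous_compact uc cA).
exists (n%:R * (`|K| + 1)) => [|s As]; first by rewrite mulr_ge0 ?addr_ge0.
apply: (le_trans (enorm_le_norm _)); rewrite ler_wpM2l//.
apply: (uK (`|K| + 1)); last by exists s.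
by rewrite (le_lt_trans (ler_norm _))// ltrDl.
Qed.

Lemma cV_sum_delta n (v : 'cV[R]_n) : v = \sum_(j < n) v j 0 *: delta_mx j 0.
Proof.
by rewrite [LHS]matrix_sum_delta; apply: eq_bigr => j _; rewrite big_ord1.
Qed.

Lemma derive_grad n (g : 'cV[R]_n -> R) (x v : 'cV[R]_n) :
  differentiable g x -> 'D_v g x = dot (grad g x) v.
Proof.
move=> dg; rewrite deriveE// [in LHS](cV_sum_delta v) linear_sum dotE.
apply: eq_bigr => j _; rewrite linearZ /= mxE deriveE//; exact: mulrC.
Qed.

Lemma MVT_grad n (g : 'cV[R]_n -> R) (x y : 'cV[R]_n) :
  (forall z, differentiable g z) ->
  exists2 s : R, 0 <= s <= 1 &
    g y - g x = dot (grad g (x + s *: (y - x))) (y - x).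
Proof.
move=> dg; pose phi (s : R) := g (x + s *: (y - x)).
pose aff (s : R) := x + s *: (y - x).
have daff s : is_diff s aff (fun h : R => h *: (y - x)).
  apply: (is_diff_eq (is_diffD (is_diff_cst x s) (is_diff_scalel s (y - x)))).
  exact: add0r.
have dphi (s : R) : is_derive s (1 : R) phi (dot (grad g (x + s *: (y - x))) (y - x)).
  have dphi : is_diff s phi ('d g (aff s) \o (fun h : R => h *: (y - x))).
    exact: is_diff_comp (daff s) (differentiableP (dg (aff s))).
  have phi_diff : differentiable phi s by [].
  apply: DeriveDef; first exact: diff_derivable.
  by rewrite deriveE// diff_val /= scale1r -deriveE// derive_grad.
have cphi : {within `[0, 1], continuous phi}.
  apply: continuous_subspaceT => s; apply: differentiable_continuous.
  exact/derivable1_diffP.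
have [s s01] := MVT_segment ler01 (fun s _ => dphi s) cphi.
rewrite subr0 mulr1 /phi scale1r scale0r addr0 [X in g X]addrC subrK => ->.
by exists s => //; rewrite in_itv/= in s01.
Qed.

Lemma enorm_segment n (x y : 'cV[R]_n) (r s : R) : 0 <= s <= 1 ->
  enorm x <= r -> enorm y <= r -> enorm (x + s *: (y - x)) <= r.
Proof.
move=> /andP[s0 s1] xr yr.
have -> : x + s *: (y - x) = (1 - s) *: x + s *: y.
  by apply/colP => i; rewrite !mxE; ring.
apply: le_trans (enorm_triangle _ _) _.
rewrite !enormZ !ger0_norm ?subr_ge0//; nra.
Qed.

Lemma C1_lipschitz n (g : 'cV[R]_n -> R) (r : R) : C1 g ->
  exists2 K : R, 0 <= K & forall x y : 'cV[R]_n,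
    enorm x <= r -> enorm y <= r -> `|g y - g x| <= K * enorm (y - x).
Proof.
move=> [dg cg].
have [K K0 gK] := compact_within_bound (@compact_enorm_ball R n r)
  (continuous_subspaceT cg).
exists K => // x y xr yr; have [s s01 ->] := MVT_grad x y dg.
apply: le_trans (cauchy_schwarz _ _) _; rewrite ler_wpM2r ?enorm_ge0//.
by apply: gK; exact: enorm_segment.
Qed.

Lemma exists_common_bound (I : finType) (P : I -> R -> Prop) :
  (forall i K K', K <= K' -> P i K -> P i K') ->
  (forall i, exists2 K : R, 0 <= K & P i K) ->
  exists2 K : R, 0 <= K & forall i, P i K.
Proof.
move=> Pmono /(_ _)/cid2-/all_sig2[K K0 PK].
exists (\sum_i K i) => [|i]; first exact: sumr_ge0.
apply: Pmono (PK i); rewrite (bigD1 i)//= lerDl; exact: sumr_ge0.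
Qed.

Lemma C2_taylor n (g : 'cV[R]_n -> R) (r : R) : C2 g ->
  exists2 K : R, 0 <= K & forall x y : 'cV[R]_n,
    enorm x <= r -> enorm y <= r ->
    `|g y - g x - dot (grad g y) (y - x)| <= K * enorm (y - x) ^+ 2.
Proof.
move=> [[dg _] dgrad].
have [K K0 gradK] : exists2 K : R, 0 <= K & forall j : 'I_n,
    forall x y : 'cV[R]_n, enorm x <= r -> enorm y <= r ->
    `|grad g y j 0 - grad g x j 0| <= K * enorm (y - x).
  apply: exists_common_bound => [j K K' KK' gK x y xr yr|j].
    by apply: le_trans (gK x y xr yr) _; rewrite ler_wpM2r ?enorm_ge0.
  exact: C1_lipschitz (dgrad j).
exists (n%:R * K) => [|x y xr yr]; first exact: mulr_ge0.
have [s /[dup] s01 /andP[s0 s1] ->] := MVT_grad x y dg.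
set z := x + _; rewrite -dotNl -dotDl.
apply: le_trans (cauchy_schwarz _ _) _; rewrite expr2 mulrA.
rewrite ler_wpM2r ?enorm_ge0// -mulrA; apply: enorm_le_bound => i.
rewrite !mxE -!/(grad g _ _ _).
have zr : enorm z <= r by exact: enorm_segment.
have := gradK i y z yr zr; rewrite !mxE => /le_trans; apply.
rewrite ler_wpM2l//.
have -> : z - y = (s - 1) *: (y - x).
  by apply/colP => j; rewrite !mxE; ring.
rewrite enormZ ler_piMl ?enorm_ge0// ler_norml; lra.
Qed.

(** The expansion is at the end point y because the implicit scheme evaluates
    the Jacobian at the new iterate. *)
Lemma stack_taylor n m (h : 'I_m -> 'cV[R]_n -> R) (r : R) :
  (forall i, C2 (h i)) ->
  exists2 K : R, 0 <= K & forall x y : 'cV[R]_n,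
    enorm x <= r -> enorm y <= r ->
    enorm (stack h y - stack h x - Jac h y *m (y - x))
      <= K * enorm (y - x) ^+ 2.
Proof.
move=> hC2.
have [K K0 hK] : exists2 K : R, 0 <= K & forall i,
    forall x y : 'cV[R]_n, enorm x <= r -> enorm y <= r ->
    `|h i y - h i x - dot (grad (h i) y) (y - x)| <= K * enorm (y - x) ^+ 2.
  apply: exists_common_bound => [i K K' KK' hK x y xr yr|i].
    by apply: le_trans (hK x y xr yr) _; rewrite ler_wpM2r ?sqr_ge0.
  exact: C2_taylor.
exists (m%:R * K) => [|x y xr yr]; first exact: mulr_ge0.
rewrite -mulrA; apply: enorm_le_bound => i.
rewrite (_ : _ i 0 = h i y - h i x - dot (grad (h i) y) (y - x)); first exact: hK.
rewrite !mxE dotE; congr (_ - _).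
by apply: eq_bigr => j _; rewrite !mxE.
Qed.

Lemma grad_reg_objective n (alpha : R) (f : 'cV[R]_n -> R -> R) (t t' : R)
    (z x : 'cV[R]_n) : differentiable (f^~ t') x ->
  grad (reg_objective alpha f t t' z) x =
  grad (f^~ t') x + (alpha / (t' - t)) *: (x - z).
Proof.
move=> df.
apply/colP => j; rewrite !mxE; set v := delta_mx j 0.
pose q (y : 'cV[R]_n) := enorm (y - z) ^+ 2.
have qE a s : s != 0 ->
    2 * dot (a - z) v + s * dot v v = s^-1 *: (q (s *: v + a) - q a).
  move=> s0; rewrite /q; have -> : s *: v + a - z = s *: v + (a - z).
    by rewrite addrA.
  rewrite !sqr_enorm; move: (a - z) => b.
  rewrite !(dotDl, dotDr, dotZl, dotZr) (dotC v b) /GRing.scale/=.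
  by field.
have dq : is_derive x v q (2 * dot (x - z) v).
  have qcvg : s^-1 *: (q (s *: v + x) - q x) @[s --> 0^'] --> 2 * dot (x - z) v.
    apply: cvg_trans (_ : 2 * dot (x - z) v + s * dot v v @[s --> 0^'] --> _).
      by apply: near_eq_cvg; near=> s; apply: qE; near: s; exact: nbhs_dnbhs_neq.
    rewrite [X in _ --> X](_ : _ = 2 * dot (x - z) v + 0 * dot v v); last first.
      by rewrite mul0r addr0.
    apply: cvgD; first exact: cvg_cst.
    by apply: cvgM; [exact: nbhs_dnbhs|exact: cvg_cst].
  by apply: DeriveDef; [apply/cvg_ex; eexists; exact: qcvg|exact: cvg_lim].
have df' : is_derive x v (f^~ t') ('D_v (f^~ t') x).
  by apply: derivableP; exact: diff_derivable.
have -> : reg_objective alpha f t t' z =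
    (f^~ t') + ((alpha / (2 * (t' - t))) \*: q).
  by apply/funext => y; rewrite /reg_objective /q/=; congr (_ + _); rewrite /GRing.scale/= mulrA mulrAC.
rewrite derive_val; congr (_ + _); rewrite dotC /dot /v.
rewrite trmx_delta -rowE !mxE /GRing.scale/= invfM.
by set w := (t' - t)^-1; field.
Unshelve. all: by end_near. Qed.

End calculus.

(** * Derivatives relative to a time interval *)

Section time.
Variable R : realType.

Lemma within_itv_proper (T t : R) : 0 < T -> t \in `[0, T] ->
  ProperFilter (within `[0, T] t^').
Proof.
move=> T0; rewrite in_itv/= => /andP[t0 tT].
apply: Build_ProperFilter_ex => A.
rewrite /within/= => /nbhs_ballP[e /= e0 eA].
have [tT'|Tt] := ltP t T.
  exists (Num.min (t + e / 2) T).
  have st : t < Num.min (t + e / 2) T by rewrite lt_min tT' ltrDl divr_gt0.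
  have se : Num.min (t + e / 2) T <= t + e / 2 by rewrite ge_min lexx.
  apply: eA => /=.
  - rewrite /ball/= ltr_distl; lra.
  - by rewrite gt_eqF.
  - rewrite in_itv/= ge_min lexx orbT andbT; lra.
exists (Num.max (t - e / 2) 0).
have st : Num.max (t - e / 2) 0 < t by rewrite gt_max; lra.
have se : t - e / 2 <= Num.max (t - e / 2) 0 by rewrite le_max lexx.
apply: eA => /=.
- rewrite /ball/= ltr_distl; lra.
- by rewrite lt_eqF.
- rewrite in_itv/= le_max lexx orbT/=; lra.
Qed.

Lemma derive_onP (V : normedModType R) (T t : R) (u : R -> V) (l : V) :
  0 < T -> t \in `[0, T] ->
  (forall e : R, 0 < e -> exists2 r : R, 0 < r & forall s, s \in `[0, T] ->
    `|s - t| <= r -> `|u s - u t - (s - t) *: l| <= e * `|s - t|) ->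
  derivable_on T u t /\ derive_on T u t = l.
Proof.
move=> T0 t0T ul; have PF := within_itv_proper T0 t0T.
suff cl : diff_quot u t s @[s --> within `[0, T] t^'] --> l.
  split; first by apply/cvg_ex; exists l.
  exact: cvg_lim.
apply/cvgrPdist_le => e e0; have [r r0 rl] := ul e e0.
rewrite /within/=; apply/nbhs_ballP; exists r => //= s.
rewrite /ball/= => str st s0T.
have st0 : s - t != 0 by rewrite subr_eq0.
rewrite -[l](scalerK st0) -scalerBr normrZ normrV ?unitfE//.
rewrite mulrC ler_pdivrMr ?normr_gt0// -normrN opprB.
by apply: rl => //; rewrite distrC ltW.
Qed.

Lemma derive_on_eps (V : normedModType R) (T t : R) (u : R -> V) :
  derivable_on T u t -> forall e : R, 0 < e ->
  exists2 r : R, 0 < r & forall s, s \in `[0, T] -> s != t -> `|s - t| < r ->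
    `|derive_on T u t - diff_quot u t s| <= e.
Proof.
move=> /cvgrPdist_le du e /du; rewrite /within/= => /nbhs_ballP[r /= r0 rdu].
by exists r => // s s0T st sr; apply: rdu => //; rewrite /ball/= distrC.
Qed.

Lemma derivable_on_continuous (V : normedModType R) (T : R) (u : R -> V) :
  (forall t, t \in `[0, T] -> derivable_on T u t) ->
  {within `[0, T], continuous u}.
Proof.
move=> du; apply/subspace_continuousP => t /= t0T.
have [r r0 rdu] := derive_on_eps (du t t0T) ltr01.
set l := derive_on T u t in rdu.
have l1 : 0 < `|l| + 1 by rewrite ltr_wpDl.
apply/cvgrPdist_le => e e0; rewrite /within/=; apply/nbhs_ballP.
exists (Num.min r (e / (`|l| + 1))) => /=; first by rewrite lt_min r0 divr_gt0.
move=> s; rewrite /ball/= lt_min distrC => /andP[sr se] s0T.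
have [->|st] := eqVneq s t; first by rewrite subrr normr0 ltW.
have st0 : s - t != 0 by rewrite subr_eq0.
have := rdu s s0T st sr; rewrite distrC => dq.
have -> : u t - u s = - ((s - t) *: diff_quot u t s).
  by rewrite /diff_quot scalerKV// opprB.
rewrite normrN normrZ; have : `|diff_quot u t s| <= `|l| + 1.
  rewrite -[diff_quot _ _ _](subrK l) (le_trans (ler_normD _ _))// addrC.
  by rewrite lerD2l.
move: se; rewrite ltr_pdivlMr// => se ql.
by apply: le_trans (ltW se); rewrite ler_wpM2l.
Qed.

Lemma derive_on_is_derive (T t : R) (u : R -> R) :
  0 < t < T -> derivable_on T u t -> is_derive t (1 : R) u (derive_on T u t).
Proof.
move=> /andP[t0 tT] du.
suff cl : h^-1 *: (u (h *: (1 : R) + t) - u t) @[h --> 0^'] --> derive_on T u t.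
  by apply: DeriveDef; [apply/cvg_ex; eexists; exact: cl|exact: cvg_lim].
apply/cvgrPdist_le => e e0; have [r r0 rdu] := derive_on_eps du e0.
apply/nbhs_ballP; exists (Num.min r (Num.min t (T - t))) => /=.
  by rewrite !lt_min r0 t0 subr_gt0.
move=> h; rewrite /ball/= sub0r normrN !lt_min => /and3P[hr ht hT] h0.
have -> : h *: (1 : R) + t = h + t by rewrite /GRing.scale/= mulr1.
have hE : h + t - t = h by rewrite addrK.
have := rdu (h + t); rewrite /diff_quot hE; apply => //.
  by move: ht hT; rewrite !ltr_norml in_itv/=; lra.
by rewrite -subr_eq0 hE.
Qed.

Lemma MVT_on (T a b : R) (u : R -> R) :
  (forall t, t \in `[0, T] -> derivable_on T u t) ->
  0 <= a -> a <= b -> b <= T ->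
  exists2 s, s \in `[a, b] & u b - u a = derive_on T u s * (b - a).
Proof.
move=> du a0 ab bT; apply: MVT_segment => // [s|].
  rewrite in_itv/= => /andP[sa sb]; apply: derive_on_is_derive; first lra.
  by apply: du; rewrite in_itv/=; lra.
apply: continuous_subspaceW (derivable_on_continuous du) => s /=.
rewrite !in_itv/=; lra.
Qed.

End time.

(** * Stability of the KKT system *)

Section kkt.
Variable R : realType.

(** Both residuals of (v', mu') control its distance to the exact solution
    (v, mu): testing the difference q + alpha w + J^T nu = 0 of the two systems,
    where w = v - v', nu = mu - mu' and q is the first residual, against w gives
      alpha |w|^2 <= |q| |w| + |nu| |J w|,
    and the lower bound on J^T turns the same equation into
    c |nu| <= alpha |w| + |q|.  No inverse of J J^T appears, so the estimate is
    usable when J varies from one step to the next. *)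
Lemma kkt_stability (n m : nat) (alpha c : R) (J : 'M[R]_(m, n))
    (v g : 'cV[R]_n) (mu : 'cV[R]_m) (v' : 'cV[R]_n) (mu' : 'cV[R]_m) :
  0 < alpha -> 0 < c -> (forall u, c * enorm u <= enorm (J^T *m u)) ->
  alpha *: v + g + J^T *m mu = 0 ->
  enorm (v - v') <= 2 / alpha * enorm (alpha *: v' + g + J^T *m mu')
                    + enorm (J *m (v - v')) / c.
Proof.
move=> alpha0 c0 cJ kkt.
set q := alpha *: v' + g + _; set w := v - v'; set nu := mu - mu'.
have kktw : J^T *m nu = - (alpha *: w + q).
  apply/eqP; rewrite -subr_eq0 opprK -[X in _ == X]kkt /w /q /nu.
  rewrite mulmxBr scalerBr; apply/eqP/colP => i; rewrite !mxE; ring.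
(* From here on only this relation between q, w and nu matters. *)
move: (q) (w) (nu) kktw => {v' mu' q w nu kkt} q w nu kktw.
have cnu : c * enorm nu <= alpha * enorm w + enorm q.
  apply: le_trans (cJ nu) _; rewrite kktw enormN.
  by apply: le_trans (enorm_triangle _ _) _; rewrite enormZ gtr0_norm.
have e : alpha * enorm w ^+ 2 = - dot q w - dot nu (J *m w).
  by rewrite -dot_trmx_mul kktw dotNl dotDl dotZl sqr_enorm; ring.
have le1 : - dot q w <= enorm q * enorm w.
  by apply: le_trans (cauchy_schwarz q w); rewrite ler_normr lexx orbT.
have le2 : - dot nu (J *m w) <= enorm nu * enorm (J *m w).
  by apply: le_trans (cauchy_schwarz _ _); rewrite ler_normr lexx orbT.
have {}le2 : - dot nu (J *m w) <=
    (alpha * enorm w + enorm q) * (enorm (J *m w) / c).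
  apply: (le_trans le2); rewrite mulrA ler_pdivlMr// mulrAC ler_wpM2r ?enorm_ge0//.
  by rewrite mulrC.
set B := enorm (J *m w) / c in le2 *.
have B0 : 0 <= B by rewrite divr_ge0 ?enorm_ge0// ltW.
have q0 := enorm_ge0 q; have w0 := enorm_ge0 w.
rewrite -(ler_pM2l alpha0) mulrDr mulrA mulrCA divff ?gt_eqF// mulr1.
(* The two bounds combine into alpha w^2 <= q w + (alpha w + q) B; when w > B
   the cross term q B is at most q w, which leaves w <= 2 q / alpha + B. *)
have [wB|Bw] := leP (enorm w) B.
  by rewrite -[leLHS]add0r lerD ?mulr_ge0// ler_wpM2l// ltW.
have wgt0 : 0 < enorm w by exact: le_lt_trans Bw.
rewrite -(ler_pM2r wgt0).
have qB : enorm q * B <= enorm q * enorm w by rewrite ler_wpM2l// ltW.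
move: e le1 le2 qB; rewrite expr2; lra.
Qed.

Lemma gram_unit (m n : nat) (J : 'M[R]_(m, n)) (c : R) : 0 < c ->
  (forall u : 'cV[R]_m, c * enorm u <= enorm (J^T *m u)) ->
  J *m J^T \in unitmx.
Proof.
move=> c0 cJ; rewrite -row_free_unit; apply: inj_row_free => u uJJ.
apply: trmx_inj; rewrite trmx0; apply: enorm_eq0.
have JJu : J *m J^T *m u^T = 0.
  by rewrite -[J *m J^T]trmxK trmx_mul trmxK -trmx_mul uJJ trmx0.
have Ju0 : enorm (J^T *m u^T) = 0.
  by apply/eqP; rewrite -sqrf_eq0 sqr_enorm dot_trmx_mul mulmxA JJu dot0r.
apply/eqP; rewrite eq_le enorm_ge0 andbT -(pmulr_rle0 _ c0).
by rewrite (le_trans (cJ _))// Ju0.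
Qed.

(** Lets the ODE be handled without its projector: v solves the KKT system of
    the quadratic problem min alpha |v|^2 / 2 + <g, v> subject to J v = b, the
    linearization satisfied in the limit by the discrete steps. *)
Lemma projected_kkt (m n : nat) (J : 'M[R]_(m, n)) (alpha : R)
    (g : 'cV[R]_n) (b : 'cV[R]_m) :
  alpha != 0 -> J *m J^T \in unitmx ->
  let v := - alpha^-1 *: ((1%:M - J^T *m invmx (J *m J^T) *m J) *m g)
           + J^T *m invmx (J *m J^T) *m b in
  J *m v = b /\ exists mu, alpha *: v + g + J^T *m mu = 0.
Proof.
move=> a0 uJ v; split.
  rewrite /v mulmxDr -scalemxAr [J *m (_ *m g)]mulmxA mulmxBr mulmx1 !mulmxA mulmxV// mul1mx.
  by rewrite subrr mul0mx scaler0 add0r mul1mx.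
exists (- (invmx (J *m J^T) *m J *m g) - alpha *: (invmx (J *m J^T) *m b)).
rewrite /v scalerDr scalerA mulrN divff// scaleN1r mulmxBl mul1mx.
rewrite mulmxBr mulmxN -scalemxAr !mulmxA.
by apply/colP => i; rewrite !mxE; ring.
Qed.

End kkt.

(** * Limits of uniformly Lipschitz schemes along an ultrafilter *)

Lemma ultra_compact_cvg (S : Type) (V : topologicalType) (U : set_system S)
    (u : S -> V) (A : set V) : UltraFilter U -> compact A ->
  (\forall s \near U, A (u s)) -> exists2 l, A l & u @ U --> l.
Proof.
move=> UU cA UA; have [l [Al ul]] := cA (u @ U) _ UA.
exists l => // B lB; have [//|UB] := in_ultra_setVsetC (u @^-1` B) UU.
by have [z [? ?]] := ul (~` B) B UB lB.
Qed.

Section telescope.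
Variables (R : realType) (n : nat).

Lemma telescope_le (Y : nat -> 'cV[R]_n) (w : 'cV[R]_n) (e : R) (j k : nat) :
  (j <= k)%N ->
  (forall i, (j <= i < k)%N -> enorm (Y i.+1 - Y i - w) <= e) ->
  enorm (Y k - Y j - (k%:R - j%:R) *: w) <= (k%:R - j%:R) * e.
Proof.
elim: k => [|k IH].
  by rewrite leqn0 => /eqP-> _; rewrite !subrr scale0r subr0 enorm0 mul0r.
rewrite leq_eqVlt => /predU1P[->|jk] Ye.
  by rewrite !subrr scale0r subr0 enorm0 mul0r.
have -> : Y k.+1 - Y j - (k.+1%:R - j%:R) *: w =
    (Y k - Y j - (k%:R - j%:R) *: w) + (Y k.+1 - Y k - w).
  by apply/colP => i; rewrite !mxE -natr1; ring.
apply: le_trans (enorm_triangle _ _) _.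
have := Ye k; rewrite -ltnS jk ltnSn => /(_ isT).
have /IH : forall i, (j <= i < k)%N -> enorm (Y i.+1 - Y i - w) <= e.
  by move=> i /andP[ji ik]; apply: Ye; rewrite ji ltnW.
rewrite -ltnS jk => /(_ isT); rewrite -[k.+1%:R]natr1; lra.
Qed.

End telescope.

Section scheme.
Variables (R : realType) (n : nat) (T : R).
Hypothesis T_gt0 : 0 < T.

Lemma grid_in N k : (0 < N)%N -> (k <= N)%N -> grid T N k \in `[0, T].
Proof.
move=> N0 kN; have N0' : 0 < N%:R :> R by rewrite ltr0n.
rewrite in_itv/= /grid divr_ge0 ?mulr_ge0 ?(ltW T_gt0)//= ler_pdivrMr// mulrC.
by rewrite ler_pM2l// ler_nat.
Qed.

Lemma gridB N j k : grid T N k - grid T N j = (k%:R - j%:R) * (T / N%:R).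
Proof. by rewrite /grid; ring. Qed.

Lemma grid_step N k : grid T N k.+1 - grid T N k = T / N%:R.
Proof. by rewrite gridB -natr1; ring. Qed.

(** Last grid point not after t: reading a discrete trajectory at this index
    turns it into a function of continuous time. *)
Definition grid_index (t : R) (N : nat) : nat := Num.truncn (t * N%:R / T).

Lemma grid_index_le t N : t \in `[0, T] -> (0 < N)%N -> (grid_index t N <= N)%N.
Proof.
rewrite in_itv/= => /andP[t0 tT] N0.
have q0 : 0 <= t * N%:R / T by rewrite divr_ge0 ?mulr_ge0// ltW.
have /andP[le1 _] := truncn_itv q0.
rewrite -(ler_nat R) (le_trans le1)// ler_pdivrMr// mulrC ler_wpM2l//.
Qed.

Lemma grid_index_homo s t N : s <= t -> (grid_index s N <= grid_index t N)%N.
Proof.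
move=> st; apply: le_truncn; rewrite ler_pM2r ?invr_gt0//.
by rewrite ler_wpM2r.
Qed.

Lemma grid_index_dist t N : t \in `[0, T] -> (0 < N)%N ->
  0 <= t - grid T N (grid_index t N) <= T / N%:R.
Proof.
rewrite in_itv/= => /andP[t0 tT] N0.
have N0' : 0 < N%:R :> R by rewrite ltr0n.
have q0 : 0 <= t * N%:R / T by rewrite divr_ge0 ?mulr_ge0// ltW.
have /andP[] := truncn_itv q0; rewrite -/(grid_index t N).
rewrite ler_pdivlMr// ltr_pdivrMr// -natr1 => le1 lt2.
rewrite /grid subr_ge0 ler_pdivrMr// le1/=.
rewrite lerBlDl -mulrDl ler_pdivlMr// ltW//; move: lt2; lra.
Qed.

Lemma grid_homo N j k : (j <= k)%N -> grid T N j <= grid T N k.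
Proof.
move=> jk; rewrite -subr_ge0 gridB mulr_ge0 ?subr_ge0 ?ler_nat//.
by rewrite divr_ge0// ltW.
Qed.

Variables (X : nat -> nat -> 'cV[R]_n) (r L : R) (U : set_system nat).
Hypothesis X_bounded : forall N k, (0 < N)%N -> (k <= N)%N -> enorm (X N k) <= r.
Hypothesis L_ge0 : 0 <= L.
Hypothesis X_step : forall N k, (0 < N)%N -> (k < N)%N ->
  enorm (X N k.+1 - X N k) <= L * (T / N%:R).
Hypothesis U_ultra : UltraFilter U.
Hypothesis U_oo : forall A, (\forall N \near \oo, A N) -> U A.

Lemma near_pos : \forall N \near U, (0 < N)%N.
Proof. by apply: U_oo; exact: nbhs_infty_gt. Qed.

Lemma near_step (e : R) : 0 < e -> \forall N \near U, T / N%:R < e.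
Proof.
move=> e0; apply: U_oo; near=> N.
have N0 : 0 < N%:R :> R by rewrite ltr0n; near: N; exact: nbhs_infty_gt.
rewrite ltr_pdivrMr// mulrC -ltr_pdivrMr//.
near: N; exact: nbhs_infty_gtr.
Unshelve. all: by end_near. Qed.

Lemma scheme_lipschitz N j k : (0 < N)%N -> (j <= N)%N -> (k <= N)%N ->
  enorm (X N k - X N j) <= L * `|grid T N k - grid T N j|.
Proof.
move=> N0; wlog jk : j k / (j <= k)%N => [wl jN kN|jN kN].
  by have [/wl->//|/ltnW/wl] := leqP j k; rewrite enorm_distC distrC; exact.
have := @telescope_le R n (X N) 0 (L * (T / N%:R)) j k jk.
rewrite scaler0 subr0 gridB => le1.
have kj0 : 0 <= (k%:R - j%:R) * (T / N%:R).
  by rewrite mulr_ge0 ?subr_ge0 ?ler_nat// divr_ge0// ltW.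
rewrite ger0_norm// mulrCA; apply: le1 => i /andP[_ ik].
by rewrite subr0 X_step// (leq_trans ik).
Qed.

Lemma cvg_grid_index t : t \in `[0, T] ->
  grid T N (grid_index t N) @[N --> U] --> t.
Proof.
move=> tT; apply/cvgrPdist_le => e e0; near=> N.
have N0 : (0 < N)%N by near: N; exact: near_pos.
have /andP[le0 le1] := grid_index_dist tT N0.
rewrite ger0_norm// (le_trans le1)// ltW//; near: N; exact: near_step.
Unshelve. all: by end_near. Qed.

(** Along an ultrafilter a bounded sequence converges, so a limit curve exists
    pointwise without extracting a subsequence.  The Lipschitz bound makes the
    value at t independent of the choice of the indices kappa, so that moving
    times may be used as well. *)
Lemma scheme_limit : exists y : R -> 'cV[R]_n,
  forall t (kappa : nat -> nat), t \in `[0, T] ->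
    (\forall N \near U, (kappa N <= N)%N) ->
    grid T N (kappa N) @[N --> U] --> t ->
    X N (kappa N) @[N --> U] --> y t.
Proof.
have lim_ex (t : R) : exists l : 'cV[R]_n, t \in `[0, T] ->
    X N (grid_index t N) @[N --> U] --> l.
  have [tT|tT] := boolP (t \in `[0, T]); last by exists 0.
  have [|l _ Xl] := ultra_compact_cvg (u := fun N => X N (grid_index t N))
    U_ultra (@compact_enorm_ball R n r); last by exists l.
  near=> N; have N0 : (0 < N)%N by near: N; exact: near_pos.
  by rewrite /= X_bounded// grid_index_le.
have [y yP] := choice lim_ex; exists y => t kappa tT kN kt.
have Xy := yP t tT.
suff d0 : X N (kappa N) - X N (grid_index t N) @[N --> U] --> (0 : 'cV[R]_n).
  rewrite -[y t]add0r (_ : (fun N => X N (kappa N)) =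
    (fun N => X N (kappa N) - X N (grid_index t N) + X N (grid_index t N))).
    exact: cvgD.
  by apply/funext => N; rewrite subrK.
apply: cvg_enorm0; apply/cvgrPdist_le => e e0.
have e1 : 0 < e / (L + 1) by rewrite divr_gt0// ltr_wpDl.
have gd : grid T N (kappa N) - grid T N (grid_index t N) @[N --> U] --> (0 : R).
  by rewrite -(subrr t); apply: cvgB => //; exact: cvg_grid_index.
move/cvgrPdist_le : gd => /(_ _ e1) gd; near=> N.
have N0 : (0 < N)%N by near: N; exact: near_pos.
rewrite sub0r normrN subr0 ger0_norm ?enorm_ge0//.
have kN' : (kappa N <= N)%N by near: N.
apply: le_trans (scheme_lipschitz N0 (grid_index_le tT N0) kN') _.
rewrite -[e](divfK (_ : L + 1 != 0)) ?gt_eqF ?ltr_wpDl// mulrC.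
apply: ler_pM => //; last by rewrite lerDl.
by rewrite -normrN -sub0r; near: N.
Unshelve. all: by end_near. Qed.

(** Between times close to t the iterates stay close to y t, hence each step is
    within e T/N of (T/N) v; summing, increments of X between a and b are within
    e (b - a) of (b - a) v, and so are those of the limit.  This replaces the
    passage to the limit in an integral equation. *)
Lemma scheme_limit_derive (y : R -> 'cV[R]_n) (t : R) (v : 'cV[R]_n) :
  t \in `[0, T] ->
  (forall s, s \in `[0, T] -> X N (grid_index s N) @[N --> U] --> y s) ->
  (forall e : R, 0 < e -> exists2 rho : R, 0 < rho &
    forall N k, (0 < N)%N -> (k < N)%N -> T / N%:R < rho ->
      enorm (X N k.+1 - y t) < rho -> `|grid T N k.+1 - t| < rho ->
      enorm (X N k.+1 - X N k - (T / N%:R) *: v) <= e * (T / N%:R)) ->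
  derivable_on T y t /\ derive_on T y t = v.
Proof.
move=> tT Xy consistent; apply: derive_onP => // e e0.
have [rho rho0 rhoP] := consistent e e0.
have L1 : 0 < 4 * (L + 1) by rewrite mulr_gt0// ltr_wpDl.
(* Iterates between times at distance at most del of t are visited at times
   within 2 del of t, hence lie within 3 L del + del < rho of y t. *)
pose del := rho / (4 * (L + 1)); have del0 : 0 < del by rewrite divr_gt0.
have delE : 4 * (L * del + del) = rho by rewrite /del; field; rewrite gt_eqF// ltr_wpDl.
have Ldel : 0 <= L * del by rewrite mulr_ge0// ltW.
suff increment a b : a \in `[0, T] -> b \in `[0, T] -> a <= b ->
    `|a - t| <= del -> `|b - t| <= del ->
    enorm (y b - y a - (b - a) *: v) <= e * (b - a).
  exists del => // s sT st; apply: le_trans (norm_le_enorm _) _.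
  have tt : `|t - t| <= del by rewrite subrr normr0 ltW.
  have [ts|/ltW ts] := leP t s.
    by rewrite ger0_norm ?subr_ge0//; exact: increment.
  rewrite distrC ger0_norm ?subr_ge0// -enormN.
  have -> : - (y s - y t - (s - t) *: v) = y t - y s - (t - s) *: v.
    by apply/colP => i; rewrite !mxE; ring.
  exact: increment.
move=> aT bT ab at_ bt.
pose j N := grid_index a N; pose k N := grid_index b N.
have cvgl : enorm (X N (k N) - X N (j N) -
    (grid T N (k N) - grid T N (j N)) *: v) @[N --> U] -->
    enorm (y b - y a - (b - a) *: v).
  apply: cvg_enorm; apply: cvgB; first by apply: cvgB; exact: Xy.
  apply: cvgZ; last exact: cvg_cst.
  by apply: cvgB; exact: cvg_grid_index.
have cvgr : e * (grid T N (k N) - grid T N (j N)) @[N --> U] --> e * (b - a).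
  apply: cvgM; first exact: cvg_cst.
  by apply: cvgB; exact: cvg_grid_index.
apply: (ler_cvg_to cvgl cvgr).
have /cvgrPdist_lt : enorm (X N (grid_index t N) - y t) @[N --> U] --> (0 : R).
  rewrite -(enorm0 R n) -(subrr (y t)); apply: cvg_enorm; apply: cvgB.
    exact: Xy.
  exact: cvg_cst.
move=> /(_ _ del0) Xt.
near=> N.
have N0 : (0 < N)%N by near: N; exact: near_pos.
have TN : T / N%:R < del by near: N; exact: near_step.
have TN0 : 0 < T / N%:R by rewrite divr_gt0// ltr0n.
have Xt' : enorm (X N (grid_index t N) - y t) < del.
  by rewrite -(ger0_norm (enorm_ge0 _)) -normrN -sub0r; near: N.
have jk : (j N <= k N)%N by exact: grid_index_homo.
have kN : (k N <= N)%N by exact: grid_index_le.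
have /andP[ja1 ja2] := grid_index_dist aT N0.
have /andP[kb1 kb2] := grid_index_dist bT N0.
have /andP[t1 t2] := grid_index_dist tT N0.
rewrite !gridB -scalerA mulrCA; apply: telescope_le => // i /andP[ji ik].
have gji := grid_homo N (leqW ji); have gik := grid_homo N ik.
have iN : (i < N)%N by exact: leq_trans ik kN.
move: at_ bt; rewrite !ler_norml => at_ bt.
have git : `|grid T N i.+1 - t| < 2 * del.
  by rewrite ltr_norml; rewrite -/(j N) in ja1 ja2; rewrite -/(k N) in kb1 kb2; lra.
apply: rhoP => //.
- rewrite (lt_le_trans TN)// -delE; lra.
- rewrite -(subrK (X N (grid_index t N)) (X N i.+1)) -addrA.
  apply: le_lt_trans (enorm_triangle _ _) _.
  have XX := scheme_lipschitz N0 (grid_index_le tT N0) iN.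
  have gg : `|grid T N i.+1 - grid T N (grid_index t N)| <= 3 * del.
    by move: git; rewrite ltr_norml ler_norml; lra.
  have := ler_wpM2l L_ge0 gg; move: delE; lra.
- rewrite (lt_le_trans git)// -delE; lra.
Unshelve. all: by end_near. Qed.

End scheme.

(** * Discrete local trajectories *)

Section trajectories.
Variables (R : realType) (n m : nat) (T alpha M : R).
Variables (f : 'cV[R]_n -> R -> R) (h : 'I_m -> 'cV[R]_n -> R).
Variable d : 'I_m -> R -> R.
Hypotheses (T_gt0 : 0 < T) (alpha_gt0 : 0 < alpha).
Hypothesis f_C1 : C1_strip T f.
Hypothesis h_C2 : forall i, C2 (h i).
Hypothesis d_C1 : forall i, C1_on T (d i).
Hypothesis f_ge : forall (x : 'cV[R]_n) (t : R), t \in `[0, T] -> M <= f x t.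
Hypothesis UB : uniform_boundedness T alpha f h d.
Hypothesis NS : non_singularity T alpha f h d.

(** The form in which the two assumptions are used.  The bound on squared
    displacements is the energy estimate: comparing the bound R2 on the
    regularized objective with f >= M leaves only the penalty term. *)
Lemma traj_uniform_bounds : exists r c E : R, [/\ 0 < c, 0 <= E &
  forall N X, (0 < N)%N -> discrete_local_trajectory T alpha f h d N X ->
  [/\ forall k, (k <= N)%N -> enorm (X k) <= r,
      forall k, (k <= N)%N -> forall u,
        c * enorm u <= enorm ((Jac h (X k))^T *m u),
      forall k, (k <= N)%N -> stack h (X k) = stack d (grid T N k),
      forall k, (k < N)%N -> exists mu,
        alpha *: ((T / N%:R)^-1 *: (X k.+1 - X k))
        + grad (f^~ (grid T N k.+1)) (X k.+1) + (Jac h (X k.+1))^T *m mu = 0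
    & forall k, (k < N)%N ->
        enorm (X k.+1 - X k) ^+ 2 <= E * (T / N%:R)]].
Proof.
have [R1 [R2 [R1_gt0 R2_gt0 bd]]] := UB.
have [c [c0 cJ]] := NS.
exists R1, c, `|2 * (R2 - M) / alpha|; split => // N X N0 trajX.
have [XR1 _ XR2] := bd N X N0 trajX; have [[h0 _] hk] := trajX.
have N0' : 0 < N%:R :> R by rewrite ltr0n.
have D0 : 0 < T / N%:R by rewrite divr_gt0.
split => //.
- by move=> k kN u; apply: sigma_minP; exact: cJ trajX k kN.
- move=> [_|k kN]; first by rewrite h0 /grid mul0r mul0r.
  by have [] := hk k kN.
- move=> k kN; have [_ [mu]] := hk k kN.
  rewrite grad_reg_objective ?grid_step; last first.
    by have [+ _ _ _] := f_C1; apply; exact: grid_in.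
  by move=> <-; exists mu; rewrite scalerA; congr (_ + _); exact: addrC.
- move=> k kN; have := XR2 k kN; rewrite /reg_objective grid_step.
  have := f_ge (X k.+1) (grid_in T_gt0 N0 kN).
  move: (T / N%:R) D0 => D D0.
  set e := enorm _ ^+ 2; set F := f _ _ => MF FR2.
  have : alpha * (e / (2 * D)) <= R2 - M by lra.
  rewrite mulrA ler_pdivrMr ?mulr_gt0// => le1.
  rewrite (@le_trans _ _ (2 * (R2 - M) / alpha * D))//; last first.
    by rewrite ler_pM2r// ler_norm.
  rewrite mulrAC ler_pdivlMr//; lra.
Qed.

Lemma grad_f_bounded (r : R) : exists2 G : R, 0 <= G &
  forall x t, enorm x <= r -> t \in `[0, T] -> enorm (grad (f^~ t) x) <= G.
Proof.
have [_ _ cf _] := f_C1.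
pose A := [set v : 'cV[R]_n | enorm v <= r] `*` `[0, T]%classic.
have cA : compact A.
  by apply: compact_setX; [exact: compact_enorm_ball|exact: segment_compact].
have cfA : {within A, continuous (fun p : 'cV[R]_n * R => grad (f^~ p.2) p.1)}.
  by apply: continuous_subspaceW cf => p [].
have [G G0 fG] := compact_within_bound cA cfA.
by exists G => // x t xr tT; exact: (fG (x, t)).
Qed.

Lemma d_lipschitz : exists2 D : R, 0 <= D & forall s t, 0 <= s -> s <= t ->
  t <= T -> enorm (stack d t - stack d s) <= D * (t - s).
Proof.
have [D D0 dD] : exists2 D : R, 0 <= D & forall i, forall t, t \in `[0, T] ->
    `|derive_on T (d i) t| <= D.
  apply: exists_common_bound => [i K K' KK' dK t tT|i].
    exact: le_trans (dK t tT) KK'.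
  have [_ cd] := d_C1 i.
  have [K [_ dK]] := compact_bounded
    (continuous_compact cd (@segment_compact _ 0 T)).
  exists (`|K| + 1) => [|t tT]; first by rewrite addr_ge0.
  apply: (dK (`|K| + 1)); last by exists t.
  by rewrite (le_lt_trans (ler_norm _))// ltrDl.
exists (m%:R * D) => [|s t s0 st tT]; first exact: mulr_ge0.
rewrite -mulrA; apply: enorm_le_bound => i; rewrite !mxE.
have [xi xist ->] := MVT_on (d_C1 i).1 s0 st tT.
rewrite normrM (ger0_norm (_ : 0 <= t - s)) ?subr_ge0//.
rewrite ler_wpM2r ?subr_ge0//; apply: dD.
by move: xist; rewrite !in_itv/=; lra.
Qed.

(** The energy bound only gives steps of order sqrt (T/N), but then the Taylor
    remainder of h along a step is O(T/N), like the variation of d.  So J times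
    the step is O(T/N), and [kkt_stability] at v' = 0, mu' = 0 gives the same for
    the step itself. *)
Lemma traj_step_bound : exists2 L : R, 0 <= L &
  forall N X, (0 < N)%N -> discrete_local_trajectory T alpha f h d N X ->
  forall k, (k < N)%N -> enorm (X k.+1 - X k) <= L * (T / N%:R).
Proof.
have [r [c [E [c0 E0 facts]]]] := traj_uniform_bounds.
have [G G0 fG] := grad_f_bounded r.
have [D D0 dD] := d_lipschitz.
have [K K0 hK] := stack_taylor r h_C2.
have a0 : 0 <= 2 / alpha by rewrite divr_ge0 ?ltW.
exists (2 / alpha * G + (D + K * E) / c) => [|N X N0 trajX k kN].
  by rewrite addr_ge0 ?mulr_ge0 ?invr_ge0 ?addr_ge0 ?mulr_ge0// ltW.
have [Xr Xc Xh Xkkt Xe] := facts N X N0 trajX.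
have [mu kkt] := Xkkt k kN.
have Dt0 : 0 < T / N%:R by rewrite divr_gt0// ltr0n.
have gridk := grid_in T_gt0 N0 (ltnW kN); have gridk1 := grid_in T_gt0 N0 kN.
have := kkt_stability 0 0 alpha_gt0 c0 (Xc k.+1 kN) kkt.
rewrite scaler0 add0r mulmx0 addr0 subr0.
have gG := fG _ _ (Xr k.+1 kN) gridk1.
have Js : enorm (Jac h (X k.+1) *m (X k.+1 - X k)) <=
    (D + K * E) * (T / N%:R).
  have -> : Jac h (X k.+1) *m (X k.+1 - X k) =
      (stack h (X k.+1) - stack h (X k)) +
      - (stack h (X k.+1) - stack h (X k) - Jac h (X k.+1) *m (X k.+1 - X k)).
    by rewrite opprB [RHS]addrC subrK.
  apply: le_trans (enorm_triangle _ _) _; rewrite enormN mulrDl; apply: lerD.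
    rewrite !Xh ?(ltnW kN)// -(grid_step T N k); apply: dD.
    - by move: gridk; rewrite in_itv/= => /andP[].
    - by rewrite -subr_ge0 grid_step ltW.
    - by move: gridk1; rewrite in_itv/= => /andP[].
  apply: le_trans (hK _ _ (Xr k (ltnW kN)) (Xr k.+1 kN)) _.
  by rewrite -mulrA ler_wpM2l// Xe.
rewrite -scalemxAr !enormZ gtr0_norm ?invr_gt0//.
move: (T / N%:R) Dt0 Js => Dt Dt0 Js.
rewrite ler_pdivrMl// => /le_trans; apply.
rewrite mulrC ler_pM2r//; apply: lerD; first by rewrite ler_wpM2l.
by rewrite ler_pM2r ?invr_gt0// mulrC ler_pdivrMr.
Qed.

Lemma strip_continuous_eps (z : 'cV[R]_n) (t : R)
    (a : 'cV[R]_n -> R -> R) (l : R) :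
  t \in `[0, T] ->
  a p.1 p.2 @[p --> within (setT `*` `[0, T]) (nbhs (z, t))] --> l ->
  forall e : R, 0 < e -> exists2 r : R, 0 < r &
    forall x s, s \in `[0, T] -> enorm (x - z) < r -> `|s - t| < r ->
      `|l - a x s| <= e.
Proof.
move=> tT /cvgrPdist_le al e /al; rewrite /within/=.
move=> /nbhs_ballP[r /= r0 ra]; exists r => // x s sT xz st.
apply: (ra (x, s)) => //; split => /=; last by rewrite /ball/= distrC.
rewrite -ball_normE/= (le_lt_trans (norm_le_enorm _))//.
by rewrite enorm_distC.
Qed.

Definition ode_rhs (x : 'cV[R]_n) (t : R) : 'cV[R]_n :=
  - alpha^-1 *: eta_map f h x t
  + theta_map h x *m stack (fun i => derive_on T (d i)) t.

Lemma cvg_Jac_entry (z : 'cV[R]_n) i j : Jac h x i j @[x --> z] --> Jac h z i j.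
Proof.
rewrite mxE; under eq_fun do rewrite mxE.
have [[_ cg] _] := h_C2 i.
by apply: (cvg_coord (F := nbhs z)); exact: cg.
Qed.

Lemma ode_rhs_kkt (x : 'cV[R]_n) (t : R) :
  Jac h x *m (Jac h x)^T \in unitmx ->
  Jac h x *m ode_rhs x t = stack (fun i => derive_on T (d i)) t /\
  exists mu,
    alpha *: ode_rhs x t + grad (f^~ t) x + (Jac h x)^T *m mu = 0.
Proof. by move=> uJ; apply: projected_kkt => //; rewrite gt_eqF. Qed.

(** For fixed v and mu the residuals that enter [kkt_stability] vary continuously
    with the point at which f and h are read, so they are small near a point
    where they vanish. *)
Lemma kkt_residual_eps (z : 'cV[R]_n) (t : R) (v : 'cV[R]_n) (mu : 'cV[R]_m) :
  t \in `[0, T] ->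
  alpha *: v + grad (f^~ t) z + (Jac h z)^T *m mu = 0 ->
  forall e : R, 0 < e -> exists2 r : R, 0 < r &
    forall x s, s \in `[0, T] -> enorm (x - z) < r -> `|s - t| < r ->
      enorm (alpha *: v + grad (f^~ s) x + (Jac h x)^T *m mu) <= e.
Proof.
move=> tT kkt e e0.
have [_ _ cf _] := f_C1.
pose a x s := enorm (alpha *: v + grad (f^~ s) x + (Jac h x)^T *m mu).
have ac : a p.1 p.2 @[p --> within (setT `*` `[0, T]) (nbhs (z, t))] --> (0 : R).
  rewrite [X in _ --> X](_ : _ =
    enorm (alpha *: v + grad (f^~ t) z + (Jac h z)^T *m mu)); last first.
    by rewrite kkt enorm0.
  apply: cvg_enorm; apply: cvgD.
    apply: cvgD; first exact: cvg_cst.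
    by have /subspace_continuousP/(_ (z, t) (conj I tT)) := cf.
  apply: cvg_mulmx; last exact: cvg_cst.
  move=> i j; rewrite mxE; under eq_fun do rewrite mxE.
  apply: (@cvg_comp _ _ _ fst (fun x => Jac h x j i) _ (nbhs z)).
    by apply: cvg_within_filter; exact: cvg_fst.
  exact: cvg_Jac_entry.
have [r r0 ar] := strip_continuous_eps tT ac e0.
exists r => // x s sT xz st; have := ar x s sT xz st.
by rewrite sub0r normrN ger0_norm ?enorm_ge0.
Qed.

Lemma constraint_residual_eps (z : 'cV[R]_n) (v : 'cV[R]_n) (b : 'cV[R]_m) :
  Jac h z *m v = b ->
  forall e : R, 0 < e -> exists2 r : R, 0 < r &
    forall x, enorm (x - z) < r -> enorm (Jac h x *m v - b) <= e.
Proof.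
move=> Jv e e0.
have : enorm (Jac h x *m v - b) @[x --> z] --> (0 : R).
  rewrite [X in _ --> X](_ : _ = enorm (Jac h z *m v - b)); last first.
    by rewrite Jv subrr enorm0.
  apply: (cvg_enorm (F := nbhs z)); apply: cvgB; last exact: cvg_cst.
  apply: (cvg_mulmx (F := nbhs z)); last exact: cvg_cst.
  exact: cvg_Jac_entry.
move=> /cvgrPdist_le/(_ e e0) /nbhs_ballP[r /= r0 rJ].
exists r => // x xz; have := rJ x.
rewrite sub0r normrN (ger0_norm (enorm_ge0 _)); apply.
rewrite -ball_normE/= (le_lt_trans (norm_le_enorm _))//.
by rewrite enorm_distC.
Qed.

(** Difference quotients over short intervals near t, not only those with end
    point t, are close to the derivative at t: this uses continuity of d'. *)
Lemma d_quotient_eps (t : R) : t \in `[0, T] ->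
  forall e : R, 0 < e -> exists2 r : R, 0 < r &
    forall s s', 0 <= s -> s < s' -> s' <= T -> `|s - t| < r -> `|s' - t| < r ->
      enorm (stack d s' - stack d s
             - (s' - s) *: stack (fun i => derive_on T (d i)) t) <= e * (s' - s).
Proof.
move=> tT e e0; set d' := stack _ t.
have e'0 : 0 < e / m.+1%:R by rewrite divr_gt0.
have : \forall s \near within `[0, T] (nbhs t), forall i : 'I_m,
    `|derive_on T (d i) t - derive_on T (d i) s| <= e / m.+1%:R.
  apply: filter_forall => i.
  have [_ /subspace_continuousP/(_ t tT)/cvgrPdist_le] := d_C1 i.
  exact.
rewrite /within/= => /nbhs_ballP[r /= r0 rd].
exists r => // s s' s0 ss' s'T st s't.
have ss0 : 0 <= s' - s by rewrite subr_ge0 ltW.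
have le_e : m%:R * (e / m.+1%:R * (s' - s)) <= e * (s' - s).
  rewrite mulrA ler_wpM2r// mulrA ler_pdivrMr// mulrC ler_pM2l//.
  by rewrite ler_nat.
apply: le_trans le_e; apply: enorm_le_bound => i.
rewrite !mxE; have [xi] := MVT_on (d_C1 i).1 s0 (ltW ss') s'T.
rewrite in_itv/= => /andP[sxi xis'] ->.
rewrite [X in _ - X]mulrC -mulrBl normrM (ger0_norm ss0) ler_wpM2r//.
rewrite distrC; apply: rd; last by rewrite /= in_itv/=; lra.
by rewrite /ball/= distrC; move: st s't; rewrite !ltr_norml; lra.
Qed.

(** Every step is consistent with the ODE, uniformly over all trajectories: near
    (z, t) the velocity of the step solves nearly the same KKT system as
    [ode_rhs z t], so [kkt_stability] applies.  The residual of the constraint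
    has three parts, from d, from the Taylor remainder of h (small because steps
    are O(T/N)) and from the variation of the Jacobian; hence the factor 3. *)
Lemma traj_consistent (z : 'cV[R]_n) (t : R) : t \in `[0, T] ->
  Jac h z *m (Jac h z)^T \in unitmx ->
  forall e : R, 0 < e -> exists2 r : R, 0 < r &
    forall N X, (0 < N)%N -> discrete_local_trajectory T alpha f h d N X ->
    forall k, (k < N)%N -> T / N%:R < r -> enorm (X k.+1 - z) < r ->
      `|grid T N k.+1 - t| < r ->
      enorm (X k.+1 - X k - (T / N%:R) *: ode_rhs z t) <= e * (T / N%:R).
Proof.
move=> tT uJ e e0.
have [rr [c [E [c0 E0 facts]]]] := traj_uniform_bounds.
have [L L0 stepL] := traj_step_bound.
have [K K0 hK] := stack_taylor rr h_C2.
have [Jv [mu kkt]] := ode_rhs_kkt t uJ; set v := ode_rhs z t in Jv kkt *.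
(* Each of the two terms of [kkt_stability] then contributes e / 2. *)
pose e1 := e * alpha / 4; pose e2 := e * c / 6.
have e10 : 0 < e1 by rewrite divr_gt0 ?mulr_gt0.
have e20 : 0 < e2 by rewrite divr_gt0 ?mulr_gt0.
have [r1 r10 H1] := kkt_residual_eps tT kkt e10.
have [r2 r20 H2] := constraint_residual_eps Jv e20.
have [r3 r30 H3] := d_quotient_eps tT e20.
have KL : 0 < K * L ^+ 2 + 1 by rewrite ltr_wpDl// mulr_ge0 ?sqr_ge0.
(* For T/N < r4 the Taylor remainder, at most K (L T/N)^2, is below e2 T/N. *)
pose r4 := e2 / (K * L ^+ 2 + 1).
have r40 : 0 < r4 by rewrite divr_gt0.
exists (Num.min (Num.min r1 r2) (Num.min (r3 / 2) r4)).
  by rewrite !lt_min r10 r20 r40 divr_gt0.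
move=> N X N0 trajX k kN; rewrite !lt_min.
move=> /andP[/andP[_ _] /andP[D3 D4]] /andP[/andP[X1 X2] _].
move=> /andP[/andP[t1 _] /andP[t3 _]].
have [Xr Xc Xh Xkkt _] := facts N X N0 trajX.
have [nu kktX] := Xkkt k kN.
have Dt0 : 0 < T / N%:R by rewrite divr_gt0// ltr0n.
have gridk := grid_in T_gt0 N0 (ltnW kN); have gridk1 := grid_in T_gt0 N0 kN.
have gs := grid_step T N k.
have := kkt_stability v mu alpha_gt0 c0 (Xc k.+1 kN) kktX.
have {}H1 := H1 _ _ gridk1 X1 t1; have {}H2 := H2 _ X2.
have {}H3 : enorm (stack d (grid T N k.+1) - stack d (grid T N k)
    - (T / N%:R) *: stack (fun i => derive_on T (d i)) t) <= e2 * (T / N%:R).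
  rewrite -gs; move: gridk gridk1; rewrite !in_itv/= => gridk gridk1.
  apply: H3; rewrite ?ltr_norml; move: t3; rewrite ?ltr_norml; lra.
have rem := hK _ _ (Xr k (ltnW kN)) (Xr k.+1 kN).
have XL := stepL N X N0 trajX k kN.
move: H3; rewrite -!Xh ?(ltnW kN)// => H3.
set d' := stack _ t in Jv H2 H3.
set J := Jac h (X k.+1) in kktX H1 H2 rem *.
set s := X k.+1 - X k in kktX rem XL *; set hh := stack h _ - stack h _ in H3 rem.
move: (T / N%:R) Dt0 D3 D4 H3 XL kktX => Dt Dt0 D3 D4 H3 XL kktX.
have -> : s - Dt *: v = Dt *: (Dt^-1 *: s - v).
  by rewrite scalerBr scalerA divff ?gt_eqF// scale1r.
have rem' : enorm (hh - J *m s) <= e2 * Dt.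
  apply: (le_trans rem).
  have : enorm s ^+ 2 <= (L * Dt) ^+ 2.
    by rewrite ler_sqr ?nnegrE ?enorm_ge0// mulr_ge0// ltW.
  move=> /(ler_wpM2l K0)/le_trans; apply.
  rewrite exprMn mulrA expr2 mulrA ler_pM2r//.
  move: D4; rewrite /r4 ltr_pdivlMr// mulrDr mulr1 mulrC; lra.
have JW : enorm (J *m (Dt^-1 *: s - v)) <= 3 * e2.
  rewrite -(ler_pM2l Dt0) -{1}(gtr0_norm Dt0) -enormZ.
  have -> : Dt *: (J *m (Dt^-1 *: s - v)) =
      (hh - Dt *: d') + (- (hh - J *m s) + - (Dt *: (J *m v - d'))).
    rewrite mulmxBr -scalemxAr scalerBr scalerA divff ?gt_eqF// scale1r.
    by rewrite scalerBr; apply/colP => i; rewrite !mxE; ring.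
  apply: le_trans (enorm_triangle _ _) _.
  apply: le_trans (lerD H3 (enorm_triangle _ _)) _.
  rewrite !enormN enormZ gtr0_norm//.
  have : Dt * enorm (J *m v - d') <= Dt * e2 by rewrite ler_pM2l.
  lra.
move=> stab; rewrite enormZ gtr0_norm// mulrC ler_pM2r//.
apply: (le_trans stab).
have -> : e = 2 / alpha * e1 + 3 * e2 / c.
  rewrite /e1 /e2; field; rewrite !gt_eqF//.
apply: lerD; first by rewrite ler_pM2l// divr_gt0.
by rewrite ler_pM2r ?invr_gt0.
Qed.

(** Continuity of the right-hand side along a curve follows from
    [kkt_stability] too, with no recourse to the continuity of inversion. *)
Lemma ode_rhs_continuous (y : R -> 'cV[R]_n) (c : R) : 0 < c ->
  (forall t, t \in `[0, T] -> forall u,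
     c * enorm u <= enorm ((Jac h (y t))^T *m u)) ->
  {within `[0, T], continuous y} ->
  {within `[0, T], continuous (fun t => ode_rhs (y t) t)}.
Proof.
move=> c0 yc cy; apply/subspace_continuousP => t tT.
have uJ s : s \in `[0, T] -> Jac h (y s) *m (Jac h (y s))^T \in unitmx.
  by move=> sT; apply: gram_unit c0 (yc s sT).
have [Jv [mu kkt]] := ode_rhs_kkt t (uJ t tT).
set v := ode_rhs (y t) t in Jv kkt *.
have yt : y s @[s --> within `[0, T] (nbhs t)] --> y t.
  by have /subspace_continuousP := cy; exact.
have yt0 : enorm (y s - y t) @[s --> within `[0, T] (nbhs t)] --> (0 : R).
  rewrite [X in _ --> X](_ : _ = enorm (y t - y t)); last by rewrite subrr enorm0.
  by apply: cvg_enorm; apply: cvgB => //; exact: cvg_cst.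
apply: cvg_enorm0; apply/cvgrPdist_le => e e0.
pose e1 := e * alpha / 4; pose e2 := e * c / 4.
have e10 : 0 < e1 by rewrite divr_gt0 ?mulr_gt0.
have e20 : 0 < e2 by rewrite divr_gt0 ?mulr_gt0.
have [r1 r10 H1] := kkt_residual_eps tT kkt e10.
have [r2 r20 H2] := constraint_residual_eps Jv e20.
have /cvgrPdist_le/(_ e2 e20) H3 :
    enorm (stack (fun i => derive_on T (d i)) s
     - stack (fun i => derive_on T (d i)) t) @[s --> within `[0, T] (nbhs t)]
    --> (0 : R).
  rewrite [X in _ --> X](_ : _ = enorm (stack (fun i => derive_on T (d i)) t
     - stack (fun i => derive_on T (d i)) t)); last by rewrite subrr enorm0.
  apply: cvg_enorm; apply: cvgB; last exact: cvg_cst.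
  apply: cvg_cV => i; rewrite mxE; under eq_fun do rewrite mxE.
  by have [_ /subspace_continuousP] := d_C1 i; apply.

move/cvgrPdist_lt : (yt0) => /(_ _ r10) Y1.
move/cvgrPdist_lt : (yt0) => /(_ _ r20) Y2.
near=> s.
have sT : s \in `[0, T].
  near: s; exact: withinT.
have Y1' : enorm (y s - y t) < r1.
  by rewrite -(ger0_norm (enorm_ge0 _)) -normrN -sub0r; near: s.
have Y2' : enorm (y s - y t) < r2.
  by rewrite -(ger0_norm (enorm_ge0 _)) -normrN -sub0r; near: s.
have st : `|s - t| < r1.
  rewrite distrC; near: s; apply: cvg_within; exact: nbhsx_ballx.
have H3' : enorm (stack (fun i => derive_on T (d i)) s
     - stack (fun i => derive_on T (d i)) t) <= e2.
  by rewrite -(ger0_norm (enorm_ge0 _)) -normrN -sub0r; near: s.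
rewrite sub0r normrN ger0_norm ?enorm_ge0//.
have [Jvs [nu kkts]] := ode_rhs_kkt s (uJ s sT).
apply: (le_trans (kkt_stability v mu alpha_gt0 c0 (yc s sT) kkts)).
have {}H1 := H1 _ _ sT Y1' st.
have {}H2 := H2 _ Y2'.
rewrite mulmxBr Jvs.
have Jle : enorm (stack (fun i => derive_on T (d i)) s - Jac h (y s) *m v)
    <= 2 * e2.
  have -> : stack (fun i => derive_on T (d i)) s - Jac h (y s) *m v =
    (stack (fun i => derive_on T (d i)) s - stack (fun i => derive_on T (d i)) t)
    - (Jac h (y s) *m v - stack (fun i => derive_on T (d i)) t).
    by apply/colP => i; rewrite !mxE; ring.
  apply: le_trans (enorm_triangle _ _) _; rewrite enormN.
  move: H2 H3'; lra.
have -> : e = 2 / alpha * e1 + 2 * e2 / c.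
  by rewrite /e1 /e2; field; rewrite !gt_eqF.
apply: lerD; first by rewrite ler_pM2l// divr_gt0.
by rewrite ler_pM2r ?invr_gt0.
Unshelve. all: by end_near. Qed.

(** The lower bound on J^T is a closed condition, so it passes from the iterates
    to y and keeps y where J J^T is invertible, the domain of the ODE. *)
Lemma limit_ode_solution (x0 : 'cV[R]_n) (X : nat -> nat -> 'cV[R]_n)
    (U : set_system nat) (y : R -> 'cV[R]_n) :
  (forall N, (0 < N)%N ->
      discrete_local_trajectory T alpha f h d N (X N) /\ X N 0%N = x0) ->
  UltraFilter U -> (forall A, (\forall N \near \oo, A N) -> U A) ->
  (forall t (kappa : nat -> nat), t \in `[0, T] ->
    (\forall N \near U, (kappa N <= N)%N) ->
    grid T N (kappa N) @[N --> U] --> t ->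
    X N (kappa N) @[N --> U] --> y t) ->
  ode_solution T alpha f h d x0 y.
Proof.
move=> X_traj UU Uoo yP.
have [r [c [E [c0 E0 facts]]]] := traj_uniform_bounds.
have [L L0 stepL] := traj_step_bound.
have X_step N k : (0 < N)%N -> (k < N)%N ->
    enorm (X N k.+1 - X N k) <= L * (T / N%:R).
  by move=> N0 kN; apply: stepL => //; have [] := X_traj N N0.
have pos := near_pos Uoo.
have Xy t : t \in `[0, T] -> X N (grid_index T t N) @[N --> U] --> y t.
  move=> tT; apply: yP => //; last exact: cvg_grid_index.
  by near=> N; apply: grid_index_le => //; near: N.
have yc t : t \in `[0, T] -> forall u,
    c * enorm u <= enorm ((Jac h (y t))^T *m u).
  move=> tT u.
  have cvgJ : enorm ((Jac h (X N (grid_index T t N)))^T *m u) @[N --> U] -->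
      enorm ((Jac h (y t))^T *m u).
    apply: cvg_enorm; apply: cvg_mulmx; last exact: cvg_cst.
    move=> i j; rewrite mxE; under eq_fun do rewrite mxE.
    apply: (cvg_comp _ (fun z => Jac h z j i) (Xy t tT)).
    exact: cvg_Jac_entry.
  apply: (ler_cvg_to (cvg_cst _) cvgJ); near=> N.
  have N0 : (0 < N)%N by near: N.
  have [trajN _] := X_traj N N0.
  have [_ Xc _ _ _] := facts N (X N) N0 trajN.
  by apply: Xc; exact: grid_index_le.
have uJ t : t \in `[0, T] -> Jac h (y t) *m (Jac h (y t))^T \in unitmx.
  by move=> tT; apply: gram_unit c0 (yc t tT).
have dy t : t \in `[0, T] ->
    derivable_on T y t /\ derive_on T y t = ode_rhs (y t) t.
  move=> tT; apply: (scheme_limit_derive T_gt0 L0 X_step UU Uoo) => //.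
  move=> e e0; have [rho rho0 rhoP] :=
    traj_consistent tT (uJ t tT) e0.
  exists rho => // N k N0 kN; apply: rhoP => //.
  by have [] := X_traj N N0.
have ycont : {within `[0, T], continuous y}.
  by apply: derivable_on_continuous => t /dy[].
split.
- split; first by move=> t /dy[].
  have : {within `[0, T], continuous (fun t => ode_rhs (y t) t)}.
    exact: ode_rhs_continuous c0 yc ycont.
  apply: subspace_eq_continuous => t; rewrite inE => tT.
  by have [_ dyt] := dy t tT; exact: esym dyt.
- have T0 : 0 \in `[0, T] by rewrite in_itv/= lexx ltW.
  have y0 : X N 0%N @[N --> U] --> y 0.
    apply: (yP 0 (fun=> 0%N)) => //; first exact: nearW.
    under eq_fun do rewrite /grid !mul0r.
    exact: cvg_cst.
  have x0y : X N 0%N @[N --> U] --> x0.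
    apply: cvg_near_cst; near=> N; apply/eqP.
    have N0 : (0 < N)%N by near: N.
    by have [_ ->] := X_traj N N0.
  exact: (cvg_unique _ y0 x0y).
- exact: uJ.
- by move=> t /dy[_ ->].
Unshelve. all: by end_near. Qed.

End trajectories.

(** * Convergence *)

Unset Implicit Arguments.

Theorem theorem2 (R : realType) (n m : nat) (T alpha M : R)
    (f : 'cV[R]_n -> R -> R) (h : 'I_m -> 'cV[R]_n -> R) (d : 'I_m -> R -> R)
    (T_gt0 : 0 < T) (alpha_gt0 : 0 < alpha)
    (f_C1 : C1_strip T f)
    (h_C2 : forall i, C2 (h i))
    (d_C2 : forall i, C2_on T (d i))
    (f_ge : forall (x : 'cV[R]_n) (t : R), t \in `[0, T] -> M <= f x t)
    (feasible : forall t : R, t \in `[0, T] -> exists x : 'cV[R]_n, stack h x = stack d t)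
    (UB : uniform_boundedness T alpha f h d)
    (NS : non_singularity T alpha f h d)
    (x0 : 'cV[R]_n)
    (x0_sol : local_solution (f^~ 0) h (stack d 0) x0)
    (x : R -> 'cV[R]_n)
    (x_ode : unique_ode_solution T alpha f h d x0 x)
    (X : nat -> nat -> 'cV[R]_n)
    (X_traj : forall N, (0 < N)%N ->
      discrete_local_trajectory T alpha f h d N (X N) /\ X N 0%N = x0) :
  \big[Num.max/0]_(k < N.+1) enorm (X N k - x (grid T N k))
    @[N --> \oo] --> (0 : R).
Proof.
have d_C1 i : C1_on T (d i) by have [] := d_C2 i.
have [r [c [E [c0 E0 facts]]]] := traj_uniform_bounds T_gt0 alpha_gt0 f_C1 f_ge UB NS.
have [L L0 stepL] := traj_step_bound T_gt0 alpha_gt0 f_C1 h_C2 d_C1 f_ge UB NS.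
pose err N := \big[Num.max/0]_(k < N.+1) enorm (X N k - x (grid T N k)).
apply/cvgrPdist_le => e e0; apply: contrapT => bad_oo.
(* The indices N with a large error are unbounded: an ultrafilter U concentrated
   on them still refines the limit at infinity. *)
pose bad := [set N | ~ (`|0 - err N| <= e)].
have bad_proper : ProperFilter (within bad \oo).
  apply: Build_ProperFilter_ex => A bA; apply: contrapT => nA.
  apply: bad_oo; move: bA; rewrite /within/=; apply: filterS => N NA; apply: contrapT => Nbad.
  by apply: nA; exists N; exact: NA.
have [U [UU badU]] := ultraFilterLemma bad_proper.
have Uoo A : (\forall N \near \oo, A N) -> U A.
  by move=> ooA; apply: badU; rewrite /within/=; apply: filterS ooA => N AN _.
have Ubad : U bad by apply: badU; exact: nearW.
have [y yP] : exists y : R -> 'cV[R]_n,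
    forall t (kappa : nat -> nat), t \in `[0, T] ->
    (\forall N \near U, (kappa N <= N)%N) ->
    grid T N (kappa N) @[N --> U] --> t ->
    X N (kappa N) @[N --> U] --> y t.
  apply: (@scheme_limit R n T T_gt0 X r L) => // N k N0 kN.
    by have [trajN _] := X_traj N N0; have [+ _ _ _ _] := facts N _ N0 trajN; apply.
  by apply: stepL => //; have [] := X_traj N N0.
have y_ode := limit_ode_solution T_gt0 alpha_gt0 f_C1 h_C2 d_C1 f_ge UB NS
  X_traj UU Uoo yP.
have [_ x_unique] := x_ode.
have yx := x_unique y y_ode.
have [[dy _] _ _ _] := y_ode.
have ycont := derivable_on_continuous dy.
(* For bad N, the index at which the maximum exceeds e. *)
have kappa_ex N : exists k, (k <= N)%N /\
    (bad N -> e < enorm (X N k - x (grid T N k))).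
  apply: contrapT => nk.
  have Nbad : bad N by apply: contrapT => ?; apply: nk; exists 0%N.
  apply: Nbad; rewrite sub0r normrN ger0_norm; last first.
    by apply: bigmax_ge_id.
  apply: bigmax_le => [|k _]; first exact: ltW.
  rewrite leNgt; apply/negP => ek; apply: nk; exists k.
  by split => //; rewrite -ltnS.
have [kappa kappaP] := choice kappa_ex.
have [|tau tauT tau_cvg] := ultra_compact_cvg
    (u := fun N => grid T N (kappa N)) UU (@segment_compact R 0 T).
  near=> N; have N0 : (0 < N)%N by near: N; exact: near_pos.
  by apply: (grid_in T_gt0 N0); have [] := kappaP N.
have Xtau : X N (kappa N) @[N --> U] --> y tau.
  by apply: yP => //; apply: nearW => N; have [] := kappaP N.
have ytau : y (grid T N (kappa N)) @[N --> U] --> y tau.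
  have /subspace_continuousP/(_ tau tauT) y_tau := ycont.
  apply: (cvg_comp (fun N => grid T N (kappa N)) y _ y_tau).
  move=> A; rewrite /within/= => tauA.
  have gA := tau_cvg _ tauA; near=> N.
  have N0 : (0 < N)%N by near: N; exact: near_pos.
  have gT : grid T N (kappa N) \in `[0, T].
    by apply: grid_in => //; have [] := kappaP N.
  by move: gT; near: N.
have : enorm (X N (kappa N) - y (grid T N (kappa N))) @[N --> U] --> (0 : R).
  rewrite [X in _ --> X](_ : _ = enorm (y tau - y tau)); last first.
    by rewrite subrr enorm0.
  by apply: cvg_enorm; exact: cvgB.
move=> /(ler_cvg_to (cvg_cst e)) H.
suff : e <= 0 by rewrite leNgt e0.
apply: H; near=> N.
have N0 : (0 < N)%N by near: N; exact: near_pos.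
have [kN kbad] := kappaP N.
rewrite yx; last exact: grid_in.
by apply/ltW/kbad; near: N.
Unshelve. all: by end_near. Qed.
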